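(* Assume that the random vector $\mathbf{x}=(x_1,\dots,x_p)^T$ follows the LiNGAM model $\mathbf{x}=\mathbf{B}\mathbf{x}+\mathbf{e}$ and that the distribution of $\mathbf{x}$ is correlation-faithful to the generating graph. Consider the following process. Find an exogenous variable $x_j$ by the criterion that $x_j$ is independent of its residuals $$r_i^{(j)}=x_i-\frac{\mathrm{cov}(x_i,x_j)}{\mathrm{var}(x_j)}\,x_j\qquad\text{for all } i\neq j,$$ and place the subscript $j$ next in the order. The LiNGAM model that holds for the $(p-1)$-dimensional residual vector $\mathbf{r}^{(j)}=(r_i^{(j)})_{i\ne j}$ can be handled as a new input model, and the same criterion can be applied to it to derive the next exogenous variable (in fact, the next exogenous residual). This process can be repeated until all variables are ordered, and the resulting order of the variable subscripts is the causal order of the original observed variables $x_1,\dots,x_p$.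
   Context: **LiNGAM model.** A random vector $\mathbf{x}=(x_1,\dots,x_p)^T$ follows the LiNGAM (linear non-Gaussian acyclic) model if $\mathbf{x}=\mathbf{B}\mathbf{x}+\mathbf{e}$, where $\mathbf{B}=(b_{ij})$ is a $p\times p$ matrix that can be made strictly lower triangular (lower triangular with all zeros on the diagonal) by simultaneous equal row and column permutations, and the external influences $e_1,\dots,e_p$ (the components of $\mathbf{e}$) are mutually independent continuous random variables having non-Gaussian distributions with zero means and non-zero variances. The entry $b_{ij}$ is the connection strength from $x_j$ to $x_i$. The same notion, with $p-1$ in place of $p$, applies to the residual vector, whose entries keep the subscripts of the corresponding original variables. **Generating graph.** The directed acyclic graph on the variables whose adjacency matrix is $\mathbf{B}$ (an edge from $x_j$ to $x_i$ when $b_{ij}\neq 0$). **Causal order.** An order $k(i)$ of the variables $x_i$ such that no later variable influences any earlier variable; that is, $b_{ji}=0$ if $k(j)<k(i)$, and $x_i=\sum_{k(j)<k(i)}b_{ij}x_j+e_i$. **Exogenous variable.** A variable $x_j$ that is not influenced by any other variable inside the model, i.e. $b_{jh}=0$ for all $h\neq j$; in the LiNGAM model this means $x_j=e_j$. **Correlation-faithfulness.** The distribution of $\mathbf{x}$ is correlation-faithful to the generating graph if correlation and conditional correlation of the $x_i$ are entailed by the graph structure, i.e. the zero/non-zero status of the $b_{ij}$, but not by special parameter values of the $b_{ij}$. *)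

(* Defs.v *)
From HB Require Import structures.
From mathcomp Require Import all_boot all_order all_algebra.
From mathcomp Require Import perm.
From mathcomp Require Import all_classical all_reals all_analysis.
From mathcomp Require Import measurable_realfun.

Set Implicit Arguments.
Unset Strict Implicit.
Unset Printing Implicit Defensive.

Import Order.TTheory GRing.Theory Num.Theory.
Import numFieldNormedType.Exports.

Local Open Scope classical_set_scope.
Local Open Scope ring_scope.

Definition cov d (T : measurableType d) (R : realType) (P : probability T R)
  (X Y : T -> R) : R := fine (covariance P X Y).

Definition var d (T : measurableType d) (R : realType) (P : probability T R)
  (X : T -> R) : R := fine ('V_P[X])%E.

Definition correlation d (T : measurableType d) (R : realType)
    (P : probability T R) (X Y : T -> R) : R :=
  cov P X Y / (Num.sqrt (var P X) * Num.sqrt (var P Y)).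

Definition independent2 d (T : measurableType d) (R : realType)
    (P : probability T R) (X Y : {RV P >-> R}) : Prop :=
  forall A C : set R, measurable A -> measurable C ->
    P (X @^-1` A `&` Y @^-1` C) = (P (X @^-1` A) * P (Y @^-1` C))%E.

Definition mutually_independent d (T : measurableType d) (R : realType)
    (P : probability T R) n (e : 'I_n -> {RV P >-> R}) : Prop :=
  forall (J : {set 'I_n}) (A : 'I_n -> set R), (forall i, measurable (A i)) ->
    P (\bigcap_(i in [set` J]) (e i @^-1` A i)) =
    (\prod_(i in J) P (e i @^-1` A i))%E.

(* "Continuous" is taken in the sense of having a density. *)
Definition continuous_rv d (T : measurableType d) (R : realType)
    (P : probability T R) (X : {RV P >-> R}) : Prop :=
  distribution P X `<< @lebesgue_measure R.

(* [normal_prob m 0] is a junk value, hence [s != 0].  The two laws are compared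
   on Borel sets only: as functions on all sets they could differ anyway. *)
Definition gaussian d (T : measurableType d) (R : realType)
    (P : probability T R) (X : {RV P >-> R}) : Prop :=
  exists m s : R, s != 0 /\
    forall A : set R, measurable A -> distribution P X A = normal_prob m s A.

Definition permutable_to_strictly_lower_triangular (R : nmodType) n
    (B : 'M[R]_n) : Prop :=
  exists s : 'S_n, forall i j : 'I_n,
    (i <= j)%N -> (row_perm s (col_perm s B)) i j = 0.

Definition linear_model d (T : measurableType d) (R : realType)
    (P : probability T R) n (x : 'I_n -> {RV P >-> R}) (B : 'M[R]_n)
    (e : 'I_n -> {RV P >-> R}) : Prop :=
  forall i t, x i t = \sum_j B i j * x j t + e i t.

(* Membership in [Lfun P 2%:E] makes the variances finite. *)
Record lingam d (T : measurableType d) (R : realType) (P : probability T R) n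
    (x : 'I_n -> {RV P >-> R}) (B : 'M[R]_n) (e : 'I_n -> {RV P >-> R}) :
    Prop := Lingam {
  lingam_model : linear_model x B e ;
  lingam_acyclic : permutable_to_strictly_lower_triangular B ;
  lingam_independent : mutually_independent e ;
  lingam_continuous : forall i, continuous_rv (e i) ;
  lingam_nongaussian : forall i, ~ gaussian (e i) ;
  lingam_square_integrable : forall i, (e i : T -> R) \in Lfun P 2%:E ;
  lingam_mean0 : forall i, ('E_P[e i] = 0)%E ;
  lingam_var_neq0 : forall i, ('V_P[e i] != 0)%E }.

Definition exogenous (R : nmodType) n (B : 'M[R]_n) (j : 'I_n) : Prop :=
  forall h, h != j -> B j h = 0.

(* What remains of x_i after least-squares regression on the x_s, s \in S.
   [invmx] is the true inverse only if the covariance matrix of (x_s), s \in S,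
   is invertible, which is the case whenever x follows a LiNGAM model. *)
Definition regression_residual d (T : measurableType d) (R : realType)
    (P : probability T R) n (x : 'I_n -> {RV P >-> R}) (S : {set 'I_n})
    (i : 'I_n) : T -> R :=
  let covSS : 'M[R]_#|S| :=
    \matrix_(a, b) cov P (x (enum_val a)) (x (enum_val b)) in
  let coviS : 'rV[R]_#|S| := \row_b cov P (x i) (x (enum_val b)) in
  let beta := coviS *m invmx covSS in
  fun t => x i t - \sum_(a < #|S|) beta 0 a * x (enum_val a) t.

(* Conditional correlation of x_i and x_k given the x_s, s \in S, in the sense
   of linear models, i.e. partial correlation; S = set0 gives the correlation. *)
Definition conditional_correlation d (T : measurableType d) (R : realType)
    (P : probability T R) n (x : 'I_n -> {RV P >-> R}) (S : {set 'I_n})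
    (i k : 'I_n) : R :=
  correlation P (regression_residual x S i) (regression_residual x S k).

(* A (conditional) correlation that vanishes has to vanish because of the
   zero/non-zero pattern of B: it vanishes for all the parameter values B' with
   that pattern. *)
Definition correlation_faithful d (T : measurableType d) (R : realType)
    (P : probability T R) n (x : 'I_n -> {RV P >-> R}) (B : 'M[R]_n)
    (e : 'I_n -> {RV P >-> R}) : Prop :=
  forall (i k : 'I_n) (S : {set 'I_n}), i != k -> i \notin S -> k \notin S ->
    conditional_correlation x S i k = 0 ->
    forall (B' : 'M[R]_n) (x' : 'I_n -> {RV P >-> R}),
      (forall a b, (B' a b == 0) = (B a b == 0)) -> linear_model x' B' e ->
      conditional_correlation x' S i k = 0.

Definition residual d (T : measurableType d) (R : realType)
    (P : probability T R) n (x : 'I_n -> {RV P >-> R}) (j i : 'I_n) :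
    {RV P >-> R} :=
  x i - cst (cov P (x i) (x j) / var P (x j)) * x j.

Definition independent_of_residuals d (T : measurableType d) (R : realType)
    (P : probability T R) n (x : 'I_n -> {RV P >-> R}) (j : 'I_n) : Prop :=
  forall i, i != j -> independent2 (x j) (residual x j i).

Definition residual_vector d (T : measurableType d) (R : realType)
    (P : probability T R) n (x : 'I_n.+1 -> {RV P >-> R}) (j : 'I_n.+1) :
    'I_n -> {RV P >-> R} :=
  fun i => residual x j (lift j i).

(* [ordering_state x y sub s]: the process started on x may reach a stage where
   the subscripts in s have been placed, in this order, and the current input is
   the vector y, whose i-th entry carries the original subscript [sub i]. *)
Inductive ordering_state d (T : measurableType d) (R : realType)
    (P : probability T R) p (x : 'I_p -> {RV P >-> R}) :
    forall n, ('I_n -> {RV P >-> R}) -> ('I_n -> 'I_p) -> seq 'I_p -> Prop :=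
| OrderingStart : ordering_state x x id [::]
| OrderingStep n (y : 'I_n.+1 -> {RV P >-> R}) (sub : 'I_n.+1 -> 'I_p) s j :
    ordering_state x y sub s -> independent_of_residuals y j ->
    ordering_state x (residual_vector y j) (sub \o lift j) (rcons s (sub j)).

Definition causal_order d (T : measurableType d) (R : realType)
    (P : probability T R) n (x : 'I_n -> {RV P >-> R}) (B : 'M[R]_n)
    (e : 'I_n -> {RV P >-> R}) (k : 'I_n -> nat) : Prop :=
  [/\ injective k,
      forall i j, (k j < k i)%N -> B j i = 0
    & forall i t, x i t = \sum_(j | (k j < k i)%N) B i j * x j t + e i t].

(* Main.v *)
Require Import Defs.
From HB Require Import structures.
From mathcomp Require Import all_boot all_order all_algebra.
From mathcomp Require Import fingroup perm.
From mathcomp Require Import all_classical all_reals all_analysis.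
From mathcomp Require Import measurable_realfun.
From mathcomp Require Import ring lra.

(** In a LiNGAM model every variable is a linear combination [x_i = sum_l A_il e_l]
    of the noise terms, with [A = (1 - B)^-1].  If x_j is exogenous then [x_j = e_j]
    and the residuals are combinations of the other noise terms, hence independent
    of x_j.  If x_j is not exogenous, let e_k be the causally first noise term other
    than e_j with [A_jk != 0].  Then [x_j = a (e_k + W)] and [x_k = e_k + Z], where
    e_k, W, Z are independent, and the residual of x_k is proportional to
    [c e_k - W + Z'] with [c = var W / var e_k].  Writing U and V for [e_k + W] and
    [c e_k - W + Z'], independence gives [E(V e^(iuU)) = 0], [E(V U e^(iuU)) = 0] and
    [E(V^2 e^(iuU)) = E(V^2) E(e^(iuU))], from which the characteristic functions of
    e_k and W solve the differential equation of Gaussian ones: e_k is Gaussian, a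
    contradiction (this is the theorem of Darmois and Skitovich for two variables,
    which needs second moments only).

    Removing x_j from the model deletes row and column j of B and the noise e_j, so
    the process can be iterated, and the exogeneity of each selected residual says
    that no later variable influences the selected one. *)

Set Implicit Arguments.
Unset Strict Implicit.
Unset Printing Implicit Defensive.

Import Order.TTheory GRing.Theory Num.Theory.
Import numFieldNormedType.Exports.

Local Open Scope classical_set_scope.
Local Open Scope ring_scope.

(** Taking e_k causally first among the noise terms of x_j other than e_j makes x_j and x_k overlap
    in e_k alone: earlier noise does not enter x_j, later noise does not enter x_k. As e_k precedes
    e_j, the term e_j sits in W, whence var W > 0 and c > 0, and the elimination may divide by c (c
    + 1). The relation obtained for phi, the characteristic function of e_k, amounts to (log phi)''
    = - var e_k, and second moments give exactly the two derivatives that this requires. The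
    obstacle is the logarithm: phi is complex and might vanish. So everything is written with real
    and imaginary parts, quotients are compared through Wronskians, and zeros are excluded
    afterwards by continuity. Knowing phi is not yet knowing the law. Two laws with the same
    characteristic function integrate every trigonometric polynomial alike; explicit polynomials in
    one cosine converge boundedly to indicators of periodic unions of intervals, and letting the
    period tend to infinity isolates a single interval. *)

(** * Independence *)

(** The formula of [independent2] on bare functions, so that linear combinations and trigonometric
    transforms need not be packaged as random variables. *)
Definition indep d (T : measurableType d) (R : realType) (P : probability T R)
    (f g : T -> R) : Prop :=
  forall A C : set R, measurable A -> measurable C ->
    P (f @^-1` A `&` g @^-1` C) = (P (f @^-1` A) * P (g @^-1` C))%E.

Section independence.
Context d (T : measurableType d) (R : realType) (P : probability T R).
Implicit Types f g h k : T -> R.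

Lemma indep_comp f g (h k : R -> R) : measurable_fun setT h ->
  measurable_fun setT k -> indep P f g -> indep P (h \o f) (k \o g).
Proof.
move=> mh mk fg A C mA mC; apply: (fg (h @^-1` A) (k @^-1` C)).
  by rewrite -[X in measurable X]setTI; exact: mh.
by rewrite -[X in measurable X]setTI; exact: mk.
Qed.

Lemma indep_sym f g : indep P f g -> indep P g f.
Proof. by move=> fg A C mA mC; rewrite setIC muleC; exact: fg. Qed.

Local Notation integ f := (P.-integrable setT (EFin \o f)).

(** Independence makes the law of the pair and the product of the two laws agree on rectangles,
    hence everywhere; Tonelli and Fubini then give both the integrability of the product and the
    factorization, from first moments alone. *)
Lemma indep_expectationM f g : integ f -> integ g -> indep P f g ->
  integ (f \* g) /\ \int[P]_t (f t * g t) = \int[P]_t f t * \int[P]_t g t.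
Proof.
move=> intf intg fg.
have /measurable_EFinP mf := measurable_int _ intf.
have /measurable_EFinP mg := measurable_int _ intg.
pose F : {RV P >-> R} := mfun_Sub (mem_set mf).
pose G : {RV P >-> R} := mfun_Sub (mem_set mg).
have mz : measurable_fun setT (fun t => (f t, g t)).
  by apply/measurable_fun_pairP.
pose Z : {mfun T >-> (R * R)%type} := mfun_Sub (mem_set mz).
pose m1 := distribution P F; pose m2 := distribution P G.
pose m := distribution P Z.
have mE X : measurable X -> (m1 \x m2)%E X = m X.
  apply: product_measure_unique => A B mA mB.
  by rewrite -(fg A B mA mB).
have im1 : m1.-integrable setT (@EFin R).
  exact: (integrable_pushforward mf (@EFin_measurable R setT) intf).
have im2 : m2.-integrable setT (@EFin R).
  exact: (integrable_pushforward mg (@EFin_measurable R setT) intg).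
pose q (z : R * R) := (z.1 * z.2)%:E.
have mq : measurable_fun setT q.
  by apply/measurable_EFinP; exact: measurable_funM.
have iq : (m1 \x m2)%E.-integrable setT q.
  apply/integrable12ltyP => //=.
  under eq_integral => x _.
    under eq_integral => y _ do rewrite normrM EFinM.
    rewrite ge0_integralZl//=; last first.
      exact/measurable_EFinP.
    over.
  rewrite ge0_integralZr//=.
  - move/integrableP : im1 => [_ /=]; move/integrableP : im2 => [_ /=] h1 h2.
    by rewrite lte_mul_pinfty//; [exact: integral_ge0|rewrite ge0_fin_numE//; exact: integral_ge0].
  - exact/measurable_EFinP.
  - exact: integral_ge0.
have iqm : m.-integrable setT q.
  apply/integrableP; split=> //; move/integrableP : iq => [_].
  rewrite (@eq_measure_integral _ _ _ _ m)//.
  by move=> A mA _; apply: mE.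
have intfg : integ (f \* g).
  apply/integrableP; split.
    by apply/measurable_EFinP; exact: measurable_funM.
  have /integrableP[_] := iqm; rewrite ge0_integral_pushforward//=.
  apply/measurable_EFinP; apply: measurableT_comp => //; exact: measurable_funM.
split=> //.
rewrite /Rintegral -fineM; try exact: integrable_fin_num.
congr fine.
have <- : (\int[m]_z q z = \int[P]_t (f t * g t)%:E)%E.
  by rewrite /m /distribution integral_pushforward// preimage_setT.
have -> : (\int[m]_z q z = \int[m1 \x m2]_z q z)%E.
  by apply: eq_measure_integral => A mA _; exact/esym/mE.
rewrite -integral12_prod_meas1// /fubini_F.
transitivity (\int[m1]_x (x%:E * \int[m2]_y y%:E))%E.
  apply: eq_integral => x _; rewrite -integralZl//.
have -> : (\int[m2]_y y%:E = \int[P]_t (g t)%:E)%E.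
  by rewrite /m2 /distribution integral_pushforward// preimage_setT.
have -> : (\int[P]_t (f t)%:E = \int[m1]_y y%:E)%E.
  by rewrite /m1 /distribution integral_pushforward// preimage_setT.
have h2 : (\int[P]_t (g t)%:E)%E \is a fin_num by exact: integrable_fin_num.
by rewrite -(fineK h2) integralZr.
Qed.

End independence.

(** * Functions of disjoint groups of independent variables *)

Section independent_groups.
Context d (T : measurableType d) (R : realType) (P : probability T R).
Variables (n : nat) (e : 'I_n -> {RV P >-> R}).
Implicit Types (J K : {set 'I_n}) (f g : T -> R).

(** A pi-system that generates the sigma-algebra of the [e i], [i \in J]. *)
Definition cylinders J : set (set T) := [set E | exists2 A : 'I_n -> set R,
  (forall i, measurable (A i)) & E = \bigcap_(i in [set` J]) (e i @^-1` A i)].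

Lemma cylinders_measurable J : cylinders J `<=` measurable.
Proof.
move=> _ [A mA ->]; apply: fin_bigcap_measurable => // i _.
by rewrite -[X in measurable X]setTI; exact: measurable_funP.
Qed.

Lemma cylindersI J : setI_closed (cylinders J).
Proof.
move=> _ _ [A mA ->] [C mC ->]; exists (fun i => A i `&` C i).
  by move=> i; exact: measurableI.
by rewrite -bigcapI.
Qed.

Lemma cylindersT J : cylinders J setT.
Proof.
exists (fun=> setT) => //; apply/esym; rewrite -subTset => t _ i _ /=.
by [].
Qed.

(** Being a function of the [e i], [i \in J], is expressed by measurability for the sigma-algebra
    they generate, which avoids product spaces whose dimension depends on [J]. *)
Definition generated_by J f :=
  measurable_fun [set: g_sigma_algebraType (cylinders J)] f.

Lemma generated_by_member J i : i \in J -> generated_by J (e i).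
Proof.
move=> iJ _ C mC; rewrite setTI; apply: sub_sigma_algebra.
exists (fun j => if j == i then C else setT).
  by move=> j; case: ifP.
apply/seteqP; split=> [t Ct j _ /=|t /(_ i iJ) /=].
  by case: eqP => // ->.
by rewrite eqxx.
Qed.

Lemma generated_by_lincomb J (a : 'I_n -> R) :
  generated_by J (fun t => \sum_(i in J) a i * e i t).
Proof.
rewrite /generated_by; under eq_fun do rewrite big_mkcond /=.
apply: measurable_sum => i; case: (boolP (i \in J)) => [iJ|_]; last exact: measurable_cst.
by apply: measurable_funM => //; exact: generated_by_member.
Qed.

Hypothesis e_indep : mutually_independent e.

Lemma cylinders_indep J K A C : [disjoint J & K]%B ->
  cylinders J A -> cylinders K C -> P (A `&` C) = (P A * P C)%E.
Proof.
move=> JK [A' mA ->] [C' mC ->].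
(* Disjointness allows both families of sets to be merged into one, to which mutual independence
   applies over [J], [K] and their union. *)
pose D i := if i \in J then A' i else C' i.
have mD i : measurable (D i) by rewrite /D; case: ifP.
have JD i : i \in J -> D i = A' i by rewrite /D => ->.
have KD i : i \in K -> D i = C' i.
  by rewrite /D => iK; rewrite (disjointFl JK iK).
have -> : \bigcap_(i in [set` J]) (e i @^-1` A' i) =
    \bigcap_(i in [set` J]) (e i @^-1` D i).
  by apply: eq_bigcapr => i /= iJ; rewrite JD.
have -> : \bigcap_(i in [set` K]) (e i @^-1` C' i) =
    \bigcap_(i in [set` K]) (e i @^-1` D i).
  by apply: eq_bigcapr => i /= iJ; rewrite KD.
rewrite -bigcap_setU.
have -> : [set` J] `|` [set` K] = [set` (J :|: K)%SET].
  by apply/seteqP; split=> i /=; rewrite finset.in_setU => /orP.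
rewrite !e_indep// -bigU//; apply: eq_bigl => i.
by rewrite finset.in_setU.
Qed.

Lemma generated_by_indep J K f g : [disjoint J & K]%B ->
  generated_by J f -> generated_by K g -> indep P f g.
Proof.
move=> JK Jf Kg A C mA mC.
have sJ : <<s cylinders J >> (f @^-1` A).
  by rewrite -[X in <<s _ >> X]setTI; exact: Jf.
have sK : <<s cylinders K >> (g @^-1` C).
  by rewrite -[X in <<s _ >> X]setTI; exact: Kg.
have sm L X : <<s cylinders L >> X -> measurable X.
  exact: (smallest_sub (@sigma_algebra_measurable _ T) (@cylinders_measurable L)).
move: (f @^-1` A) (g @^-1` C) sJ sK => {A C mA mC Jf Kg f g} A C sA sC.
(* For fixed [X] both sides are finite measures in [Y], so agreement on a pi-system extends to the
   sigma-algebra that it generates. This is used once per group. *)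
have step L (X Y : set T) : measurable X ->
    (forall Z, cylinders L Z -> P (Z `&` X) = P Z * P X)%E ->
    <<s cylinders L >> Y -> (P (Y `&` X) = P Y * P X)%E.
  move=> mX LX sY.
  have PX0 : (0 <= fine (P X))%R by apply: fine_ge0.
  have fX : ((fine (P X))%:E = P X)%E by rewrite fineK ?fin_num_measure.
  rewrite muleC -fX.
  apply: (@g_sigma_algebra_measure_unique _ _ _ (cylinders L)
     (@cylinders_measurable L) (fun=> setT) (fun=> @cylindersT L) _
     (mrestr P mX) (mscale (NngNum PX0) P) (@cylindersI L) _ _ Y sY).
  - by apply/seteqP; split=> // t _; exists 0%N.
  - move=> Z LZ; change (P (Z `&` X) = ((fine (P X))%:E * P Z)%E).
    by rewrite LX// muleC fX.
  - move=> _; change (P (setT `&` X) < +oo)%E.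
    by rewrite ltey_eq fin_num_measure//; exact: measurableI.
apply: (step J) => //; first exact: sm sC.
move=> Z JZ; rewrite setIC muleC; apply: (step K) => //.
  exact: cylinders_measurable JZ.
by move=> Z' KZ'; apply: cylinders_indep KZ' JZ; rewrite disjoint_sym.
Qed.

End independent_groups.

(** * Characteristic functions *)

Section trigonometric_moments.
Context d (T : measurableType d) (R : realType).
Variable mu : {measure set T -> \bar R}.
Local Notation integ f := (mu.-integrable setT (EFin \o f)).
Implicit Types (f g h X : T -> R).

Lemma integrable_le_normr f g : measurable_fun setT f -> integ g ->
  (forall t, `|f t| <= `|g t|) -> integ f.
Proof.
move=> mf ig fg; apply: le_integrable ig => //; first exact/measurable_EFinP.
by move=> t _; rewrite /= lee_fin.
Qed.

Lemma integrable_mulr_le1 g h : integ g -> measurable_fun setT h ->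
  (forall t, `|h t| <= 1) -> integ (g \* h).
Proof.
move=> ig mh h1.
have /measurable_EFinP mg := measurable_int _ ig.
apply: (integrable_le_normr _ ig); first exact: measurable_funM.
by move=> t; rewrite normrM ler_piMr.
Qed.

Lemma measurable_sin_scale X (u : R) : measurable_fun setT X ->
  measurable_fun setT (fun t => sin (u * X t)).
Proof.
move=> mX; apply: (measurableT_comp (f := sin)).
  by apply: continuous_measurable_fun; exact: continuous_sin.
exact: measurable_funM.
Qed.

Lemma measurable_cos_scale X (u : R) : measurable_fun setT X ->
  measurable_fun setT (fun t => cos (u * X t)).
Proof.
move=> mX; apply: (measurableT_comp (f := cos)).
  by apply: continuous_measurable_fun; exact: continuous_cos.
exact: measurable_funM.
Qed.

Lemma normr_sin_le1 (x : R) : `|sin x| <= 1.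
Proof. by rewrite ler_norml sin_geN1 sin_le1. Qed.

Lemma normr_cos_le1 (x : R) : `|cos x| <= 1.
Proof. by rewrite ler_norml cos_geN1 cos_le1. Qed.

(** Since [w'] is bounded by 1, [|g * X|] dominates the derivative for all parameters at once: each
    differentiation costs one moment of [X]. *)
Lemma is_derive_under_integral g X (w w' : R -> R) (u : R) :
  (forall x : R, is_derive x 1 w (w' x)) ->
  (forall x, `|w x| <= 1) -> (forall x, `|w' x| <= 1) ->
  measurable_fun setT X -> integ g -> integ (g \* X) ->
  is_derive u 1 (fun v : R => \int[mu]_t (g t * w (v * X t)))
    (\int[mu]_t (g t * X t * w' (u * X t))).
Proof.
move=> dw w1 w'1 mX ig igX.
have cw : continuous w.
  move=> x; apply: differentiable_continuous.
  by apply/derivable1_diffP; have := dw x => -[].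
have mw : measurable_fun setT w by exact: continuous_measurable_fun.
pose f v t := g t * w (v * X t).
have df (v : R) t : is_derive v 1 (f ^~ t) (g t * X t * w' (v * X t)).
  have lin : is_derive v 1 (fun v => v * X t) (X t).
    have -> : (fun v => v * X t) = (@idfun R) * cst (X t) by [].
    by apply: is_derive_eq; rewrite /GRing.scale /= mulr1 mulr0 add0r.
  have wlin : is_derive v 1 (w \o (fun v => v * X t)) (w' (v * X t) * X t).
    by apply: is_derive1_comp.
  have -> : (f ^~ t) = cst (g t) * (w \o (fun v => v * X t)) by [].
  apply: is_derive_eq.
  by rewrite /GRing.scale /= mulr0 addr0 -mulrA [w' _ * _]mulrC.
have uI : `]u - 1, u + 1[%classic u.
  by rewrite /= in_itv /=; apply/andP; split; lra.
have d1f (v : R) t : partial1of2 f v t = g t * X t * w' (v * X t).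
  by rewrite partial1of2E; have [_ ->] := df v t.
have intf v : mu.-integrable setT (EFin \o f v).
  apply: integrable_mulr_le1 => //.
  by apply: measurableT_comp => //; exact: measurable_funM.
have intG : mu.-integrable setT (EFin \o (fun t => `|g t * X t|)).
  exact: integrable_norm.
have Gub v t : `]u - 1, u + 1[%classic v -> setT t -> `|partial1of2 f v t| <= `|g t * X t|.
  by move=> _ _; rewrite d1f normrM ler_piMr.
have der v t : `]u - 1, u + 1[%classic v -> setT t -> derivable (f ^~ t) v 1.
  by move=> _ _; have [] := df v t.
have G0 t : 0 <= `|g t * X t| by [].
apply: DeriveDef.
  exact: (derivable_under_integral measurableT uI (fun v _ => intf v) der G0 intG Gub).
rewrite -derive1E.
rewrite (differentiation_under_integral measurableT uI (fun v _ => intf v) der G0 intG Gub).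
by apply: eq_Rintegral => t _; rewrite d1f.
Qed.

Lemma is_derive_cos_moment g X (u : R) :
  measurable_fun setT X -> integ g -> integ (g \* X) ->
  is_derive u 1 (fun v : R => \int[mu]_t (g t * cos (v * X t)))
    (- \int[mu]_t (g t * X t * sin (u * X t))).
Proof.
move=> mX ig igX; apply: is_derive_eq.
  apply: (@is_derive_under_integral g X cos (fun x => - sin x)) => //.
  - exact: normr_cos_le1.
  - by move=> x; rewrite normrN normr_sin_le1.
rewrite -mulN1r -RintegralZl//.
  by apply: eq_Rintegral => t _; rewrite mulrN mulN1r.
apply: integrable_mulr_le1 => //.
  exact: measurable_sin_scale.
move=> t; exact: normr_sin_le1.
Qed.

Lemma is_derive_sin_moment g X (u : R) :
  measurable_fun setT X -> integ g -> integ (g \* X) ->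
  is_derive u 1 (fun v : R => \int[mu]_t (g t * sin (v * X t)))
    (\int[mu]_t (g t * X t * cos (u * X t))).
Proof.
move=> mX ig igX; apply: is_derive_under_integral => // x.
  exact: normr_sin_le1.
exact: normr_cos_le1.
Qed.

End trigonometric_moments.

(** * Differential equations that characterize Gaussian characteristic functions *)

Section linear_ode.
Variable R : realType.
Implicit Types f g : R -> R.

Lemma is_derive_continuous f (f' : R -> R) :
  (forall x : R, is_derive x (1 : R) f (f' x)) -> continuous f.
Proof.
move=> df x; apply: differentiable_continuous.
by apply/derivable1_diffP; have := df x => -[].
Qed.

Lemma is_derive1M f g (x a b : R) : is_derive x (1 : R) f a ->
  is_derive x (1 : R) g b -> is_derive x (1 : R) (f * g) (f x * b + g x * a).
Proof. by move=> df dg; apply: is_deriveM. Qed.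

Lemma is_derive1D f g (x a b : R) : is_derive x (1 : R) f a ->
  is_derive x (1 : R) g b -> is_derive x (1 : R) (f + g) (a + b).
Proof. by move=> df dg; apply: is_deriveD. Qed.

Lemma is_derive1B f g (x a b : R) : is_derive x (1 : R) f a ->
  is_derive x (1 : R) g b -> is_derive x (1 : R) (f - g) (a - b).
Proof. by move=> df dg; apply: is_deriveB. Qed.

Lemma is_derive1_eq f (x a b : R) : is_derive x (1 : R) f a -> a = b ->
  is_derive x (1 : R) f b.
Proof. by move=> ? <-. Qed.

(** The hypothesis on the derivatives says that f / g has derivative zero on [0, t], so the quotient
    keeps its value 0 by the mean value theorem. *)
Lemma wronskian_eq0 f g (f' g' : R -> R) t : 0 <= t ->
  (forall x : R, is_derive x (1 : R) f (f' x)) ->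
  (forall x : R, is_derive x (1 : R) g (g' x)) ->
  (forall x, 0 <= x <= t -> g x != 0) ->
  (forall x, 0 <= x <= t -> f' x * g x = f x * g' x) ->
  f 0 = 0 -> f t = 0.
Proof.
move=> t0 df dg g0 fg f0.
pose gV x := (g x)^-1.
have dh x : 0 <= x <= t -> is_derive x (1 : R) (f * gV) 0.
  move=> xt; have gx0 := g0 _ xt.
  have dgV : is_derive x (1 : R) gV (- (g x) ^- 2 *: g' x) by exact: is_deriveV.
  apply: is_derive_eq; rewrite /GRing.scale /= /gV.
  have gg : g x * (g x)^-1 = 1 by rewrite mulfV.
  rewrite -exprVn expr2.
  transitivity ((f' x * g x - f x * g' x) * ((g x)^-1 * (g x)^-1)).
    rewrite mulrBl -[f' x * g x * _]mulrA [g x * (_ * _)]mulrA gg mul1r.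
    ring.
  by rewrite fg// subrr mul0r.
have [| |c ct] := @MVT_segment R (f * gV) (fun=> 0) 0 t t0.
- move=> x; rewrite in_itv/= => /andP[x0 xt]; apply: dh.
  by rewrite !ltW.
- apply: derivable_within_continuous => x; rewrite in_itv/= => xt.
  by have := dh _ xt => -[].
rewrite mul0r => /eqP; rewrite subr_eq0 => /eqP.
have tt : 0 <= t <= t by rewrite t0 lexx.
rewrite !fctE f0 mul0r => /eqP; rewrite mulf_eq0 invr_eq0 (negbTE (g0 _ tt)) orbF.
by move/eqP.
Qed.

Lemma is_derive_gaussian (v x : R) :
  is_derive x (1 : R) (fun u => expR (- v * u ^+ 2 / 2))
    (- v * x * expR (- v * x ^+ 2 / 2)).
Proof.
pose q : R -> R := cst (- v / 2) * (@idfun R) ^+ 2.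
have dq : is_derive x (1 : R) q (- v * x).
  apply: is_derive_eq; rewrite /GRing.scale /= expr1 !mulr1 mulr0 addr0.
  by field.
have -> : (fun u => expR (- v * u ^+ 2 / 2)) = expR \o q.
  by apply/funext => u /=; rewrite /q !fctE /=; congr expR; field.
apply: is_derive_eq.
rewrite /q !fctE /= [LHS]mulrC; congr (- v * x * expR _); by field.
Qed.

(* The intended instance is [c + i s = phi], [c1 + i s1 = E(X e^(iuX))] and
   [c2 + i s2 = E(X^2 e^(iuX))], where phi is the characteristic function of a
   centered X. *)
Record trig_system (c s c1 s1 c2 s2 : R -> R) : Prop := TrigSystem {
  trig_c : forall u : R, is_derive u (1 : R) c (- s1 u) ;
  trig_s : forall u : R, is_derive u (1 : R) s (c1 u) ;
  trig_c1 : forall u : R, is_derive u (1 : R) c1 (- s2 u) ;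
  trig_s1 : forall u : R, is_derive u (1 : R) s1 (c2 u) ;
  trig_c0 : c 0 = 1 ;
  trig_s0 : s 0 = 0 ;
  trig_c10 : c1 0 = 0 ;
  trig_s10 : s1 0 = 0 }.

(* The hypotheses on [c1] and [s1] say that [phi := c + i s] satisfies
   [phi' = - v u phi]. *)
Lemma gaussian_ode c s c1 s1 (v t : R) : 0 <= t ->
  (forall u : R, is_derive u (1 : R) c (- s1 u)) ->
  (forall u : R, is_derive u (1 : R) s (c1 u)) ->
  (forall u, 0 <= u <= t -> c1 u = - v * u * s u) ->
  (forall u, 0 <= u <= t -> s1 u = v * u * c u) ->
  c 0 = 1 -> s 0 = 0 ->
  c t = expR (- v * t ^+ 2 / 2) /\ s t = 0.
Proof.
move=> t0 dc ds c1E s1E c0 s0.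
pose E (u : R) := expR (- v * u ^+ 2 / 2).
have dE (u : R) : is_derive u (1 : R) E (- v * u * E u).
  exact: is_derive_gaussian.
have E0 u : E u != 0 by rewrite gt_eqF// expR_gt0.
split.
  apply/eqP; rewrite -subr_eq0; apply/eqP.
  have dcE (u : R) : is_derive u (1 : R) (c - E) (- s1 u + v * u * E u).
    by apply: is_derive_eq; rewrite !mulNr opprK.
  apply: (@wronskian_eq0 (c - E) E _ _ t t0 dcE dE) => //.
    by move=> u ut; rewrite s1E// !fctE; ring.
  by rewrite !fctE /E c0 expr0n/= mulr0 mul0r expR0 subrr.
apply: (@wronskian_eq0 s E _ _ t t0 ds dE) => // u ut.
by rewrite c1E//; ring.
Qed.

(* In complex terms the hypothesis is [phi phi2 - phi1^2 = v phi^2], which makes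
   [D := phi1 - i v u phi] satisfy [phi D' = i phi1 D]; so [|D|^2 / |phi|^2] is
   constant, and it vanishes at 0. *)
Lemma trig_system_gaussian c s c1 s1 c2 s2 (v t : R) : 0 <= t ->
  trig_system c s c1 s1 c2 s2 ->
  (forall u, 0 <= u <= t -> c u ^+ 2 + s u ^+ 2 != 0) ->
  (forall u, 0 <= u <= t ->
    c u * c2 u - s u * s2 u - c1 u ^+ 2 + s1 u ^+ 2 =
      v * (c u ^+ 2 - s u ^+ 2) /\
    c u * s2 u + s u * c2 u - c1 u * s1 u *+ 2 = v * (c u * s u) *+ 2) ->
  c t = expR (- v * t ^+ 2 / 2) /\ s t = 0.
Proof.
move=> t0 [dc ds dc1 ds1 c0 s0 c10 s10] N0 K.
pose N : R -> R := c * c + s * s.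
have dN (u : R) : is_derive u (1 : R) N ((s u * c1 u - c u * s1 u) *+ 2).
  apply: (is_derive1_eq (is_derive1D (is_derive1M (dc u) (dc u))
    (is_derive1M (ds u) (ds u)))).
  ring.
pose l : R -> R := cst v * (@idfun R).
have dl (u : R) : is_derive u (1 : R) l v.
  by apply: is_derive_eq; rewrite /GRing.scale /= mulr0 addr0 mulr1.
pose Dr : R -> R := c1 + l * s; pose Di : R -> R := s1 - l * c.
have dDr (u : R) : is_derive u (1 : R) Dr (- s2 u + v * s u + v * u * c1 u).
  apply: (is_derive1_eq (is_derive1D (dc1 u) (is_derive1M (dl u) (ds u)))).
  by rewrite /l !fctE /=; ring.
have dDi (u : R) : is_derive u (1 : R) Di (c2 u - v * c u + v * u * s1 u).
  apply: (is_derive1_eq (is_derive1B (ds1 u) (is_derive1M (dl u) (dc u)))).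
  by rewrite /l !fctE /=; ring.
pose q : R -> R := Dr * Dr + Di * Di.
have dq (u : R) : is_derive u (1 : R) q
    ((Dr u * (- s2 u + v * s u + v * u * c1 u) +
      Di u * (c2 u - v * c u + v * u * s1 u)) *+ 2).
  apply: (is_derive1_eq (is_derive1D (is_derive1M (dDr u) (dDr u))
    (is_derive1M (dDi u) (dDi u)))).
  ring.
have q0 u : 0 <= u <= t -> q u = 0.
  move=> /andP[u0 ut].
  have sub x : 0 <= x <= u -> 0 <= x <= t.
    by move=> /andP[-> xu]; exact: le_trans ut.
  apply: (@wronskian_eq0 q N _ _ u u0 dq dN).
  - by move=> x /sub /N0; rewrite /N !fctE !expr2.
  - move=> x /sub /K [Kr Ki]; apply/eqP; rewrite -subr_eq0; apply/eqP.
    (* [X] and [Y] are the real and imaginary parts of D phi. With these coefficients the Wronskian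
       of [q] and [N] is a linear combination of the two relations in [K]. *)
    pose X := Dr x * c x - Di x * s x; pose Y := Dr x * s x + Di x * c x.
    transitivity (- (X * (c x * s2 x + s x * c2 x - c1 x * s1 x *+ 2 -
                          v * (c x * s x) *+ 2)
      - Y * (c x * c2 x - s x * s2 x - c1 x ^+ 2 + s1 x ^+ 2 -
             v * (c x ^+ 2 - s x ^+ 2))) *+ 2).
      by rewrite /X /Y /N /q /Dr /Di /l !fctE /=; ring.
    by rewrite Kr Ki !subrr !mulr0 subrr oppr0 mul0rn.
  - by rewrite /q /Dr /Di /l !fctE /= c10 s10; ring.
have D0 u : 0 <= u <= t -> Dr u = 0 /\ Di u = 0.
  move/q0; rewrite /q !fctE -!expr2 => /eqP.
  by rewrite paddr_eq0 ?sqr_ge0// !sqrf_eq0 => /andP[/eqP-> /eqP->].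
apply: (@gaussian_ode c s c1 s1) => // u /D0[].
  by rewrite /Dr /l !fctE /= => /eqP; rewrite addr_eq0 => /eqP ->; rewrite !mulNr.
by rewrite /Di /l !fctE /= => _ /eqP; rewrite subr_eq0 => /eqP.
Qed.

(* The relations hold only where both characteristic functions are nonzero; at
   the first zero of their product they would, by continuity, take the nonzero
   values of Gaussian ones. *)
Lemma trig_system_pair_gaussian c s c1 s1 c2 s2 d r d1 r1 d2 r2 (v w : R) :
  trig_system c s c1 s1 c2 s2 -> trig_system d r d1 r1 d2 r2 ->
  (forall u, c u ^+ 2 + s u ^+ 2 != 0 -> d u ^+ 2 + r u ^+ 2 != 0 ->
    (c u * c2 u - s u * s2 u - c1 u ^+ 2 + s1 u ^+ 2 =
      v * (c u ^+ 2 - s u ^+ 2) /\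
    c u * s2 u + s u * c2 u - c1 u * s1 u *+ 2 = v * (c u * s u) *+ 2) /\
    (d u * d2 u - r u * r2 u - d1 u ^+ 2 + r1 u ^+ 2 =
      w * (d u ^+ 2 - r u ^+ 2) /\
    d u * r2 u + r u * d2 u - d1 u * r1 u *+ 2 = w * (d u * r u) *+ 2)) ->
  forall t, 0 <= t -> c t = expR (- v * t ^+ 2 / 2) /\ s t = 0.
Proof.
move=> Sc Sd K.
pose M (u : R) := (c u ^+ 2 + s u ^+ 2) * (d u ^+ 2 + r u ^+ 2).
pose E (u : R) := (expR (- v * u ^+ 2 / 2) * expR (- w * u ^+ 2 / 2)) ^+ 2.
have E0 u : E u != 0 by rewrite expf_neq0// gt_eqF// mulr_gt0 ?expR_gt0.
have main (t : R) : 0 <= t -> (forall u : R, 0 <= u <= t -> M u != 0) ->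
    (c t = expR (- v * t ^+ 2 / 2) /\ s t = 0) /\
    (d t = expR (- w * t ^+ 2 / 2) /\ r t = 0).
  move=> t0 M0; split.
    apply: (trig_system_gaussian t0 Sc).
      by move=> u /M0; rewrite mulf_eq0 negb_or => /andP[].
    by move=> u /M0; rewrite mulf_eq0 negb_or => /andP[h1 h2]; apply (K _ h1 h2).
  apply: (trig_system_gaussian t0 Sd).
    by move=> u /M0; rewrite mulf_eq0 negb_or => /andP[].
  by move=> u /M0; rewrite mulf_eq0 negb_or => /andP[h1 h2]; apply (K _ h1 h2).
suff M0 (t : R) : 0 <= t -> M t != 0.
  move=> t t0; apply: (proj1 (main t t0 _)).
  by move=> u /andP[u0 _]; exact: M0.
have cM : continuous M.
  have [/is_derive_continuous cc /is_derive_continuous cs _ _ _ _ _ _] := Sc.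
  have [/is_derive_continuous cd /is_derive_continuous cr _ _ _ _ _ _] := Sd.
  move=> x; apply: cvgM; apply: cvgD; rewrite !expr2.
  - by apply: cvgM; exact: cc.
  - by apply: cvgM; exact: cs.
  - by apply: cvgM; exact: cd.
  - by apply: cvgM; exact: cr.
have cE : continuous E.
  move=> x; rewrite /E; under eq_fun do rewrite expr2.
  have h w' : {for x, continuous (fun u : R => expR (- w' * u ^+ 2 / 2))}.
    by have := @is_derive_continuous _ _ (is_derive_gaussian w'); exact.
  by apply: cvgM; apply: cvgM; exact: h.
move=> t0; apply/negP => /eqP Mt.
pose A := [set u | 0 <= u /\ M u = 0].
have At : A t by [].
have hA : has_inf A by split; [exists t|exists 0 => u []].
pose tau := inf A.
have tau0 : 0 <= tau by apply: lb_le_inf; [exists t|move=> u []].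
have below (u : R) : 0 <= u -> u < tau -> M u != 0.
  move=> u0 ut; apply/negP => /eqP Mu.
  by have := ge_inf hA.2 (conj u0 Mu : A u); rewrite leNgt ut.
have ME (u : R) : 0 <= u -> u < tau -> M u = E u.
  move=> u0 ut; rewrite /M /E; have [|[-> ->] [-> ->]] := main u u0.
    by move=> x /andP[x0 xu]; apply: below => //; exact: le_lt_trans ut.
  ring.
(* [tau] is an infimum of zeros. The value there is controlled from the left, where [M = E]; the
   case [tau = 0] has no left side and uses the initial values. Nonvanishing near [tau] then
   contradicts the zeros that accumulate at the infimum. *)
have Mtau : M tau != 0.
  have [->|tau_neq0] := eqVneq tau 0.
    rewrite /M; have [_ _ _ _ -> -> _ _] := Sc; have [_ _ _ _ -> -> _ _] := Sd.
    by rewrite expr1n expr0n/= addr0 mulr1 oner_neq0.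
  have tau_gt0 : 0 < tau by rewrite lt_neqAle eq_sym tau_neq0.
  suff -> : M tau = E tau by [].
  apply/eqP; rewrite -subr_eq0; apply/negPn/negP => ME0.
  have cME : {for tau, continuous (fun u : R => M u - E u)}.
    by apply: cvgB; [exact: cM|exact: cE].
  have [e /= e0 He] : \forall u \near tau, M u - E u != 0.
    exact: (cvgr_neq0 _ cME ME0).
  pose u := Num.max 0 (tau - e / 2).
  have u0 : 0 <= u by rewrite le_max lexx.
  have ut : u < tau by rewrite gt_max tau_gt0 /=; lra.
  have : M u - E u != 0.
    apply: He; rewrite /= ltr_distlC ltr_wpDr ?ltW// andbT.
    by rewrite lt_max; apply/orP; right; lra.
  by rewrite ME// subrr eqxx.
have : \forall u \near tau, M u != 0.
  exact: (cvgr_neq0 _ (cM tau) Mtau).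
move=> [e /= e0 He].
have [a [a0 Ma] ae] := inf_adherent e0 hA.
have : M a != 0.
  apply: He; rewrite /= ltr_distlC.
  by have := ge_inf hA.2 (conj a0 Ma : A a); rewrite -/tau in ae *; lra.
by rewrite Ma eqxx.
Qed.

End linear_ode.

(** * The two-variable theorem of Darmois and Skitovich *)

Section darmois_skitovich.
Context d (T : measurableType d) (R : realType) (P : probability T R).
Local Notation integ f := (P.-integrable setT (EFin \o f)).
Implicit Types f g h X W Z : T -> R.

Lemma integrable_measurable f : integ f -> measurable_fun setT f.
Proof. by move=> /integrableP[/measurable_EFinP]. Qed.

Lemma eqfun_integrable f g : f =1 g -> integ f -> integ g.
Proof. by move=> /funext ->. Qed.

Lemma integrable_addr f g : integ f -> integ g -> integ (fun t => f t + g t).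
Proof.
by move=> iF iG; apply: eq_integrable (integrableD measurableT iF iG).
Qed.

Lemma integrable_scaler (r : R) f : integ f -> integ (fun t => r * f t).
Proof.
by move=> iF; apply: eq_integrable (integrableZl measurableT r iF).
Qed.

Lemma integrable_lin3 (a b c : R) f g h : integ f -> integ g -> integ h ->
  integ (fun t => a * f t + b * g t + c * h t).
Proof.
move=> iF iG iH; apply: integrable_addr; last exact: integrable_scaler.
by apply: integrable_addr; exact: integrable_scaler.
Qed.

Lemma Rintegral_lin3 (a b c : R) f g h : integ f -> integ g -> integ h ->
  \int[P]_t (a * f t + b * g t + c * h t) =
  a * \int[P]_t f t + b * \int[P]_t g t + c * \int[P]_t h t.
Proof.
move=> iF iG iH.
have ia := integrable_scaler a iF; have ib := integrable_scaler b iG.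
have ic := integrable_scaler c iH.
by rewrite RintegralD ?RintegralD ?RintegralZl//; exact: integrable_addr.
Qed.

Lemma integrable_cst1 : integ (fun=> 1 : R).
Proof. exact: finite_measure_integrable_cst. Qed.

Lemma Rintegral_probability_cst (r : R) : \int[P]_t r = r.
Proof.
rewrite Rintegral_cst// -[RHS]mulr1; congr (_ * _).
exact: (congr1 fine (probability_setT P)).
Qed.

(** The factor 1 is kept so that the first two functions are moments of the same shape as the
    others, with weight [g = 1]. *)
Lemma trig_system_moments X : integ X -> integ (X \* X) ->
  \int[P]_t X t = 0 ->
  trig_system (fun u => \int[P]_t (1 * cos (u * X t)))
    (fun u => \int[P]_t (1 * sin (u * X t)))
    (fun u => \int[P]_t (X t * cos (u * X t)))
    (fun u => \int[P]_t (X t * sin (u * X t)))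
    (fun u => \int[P]_t ((X \* X) t * cos (u * X t)))
    (fun u => \int[P]_t ((X \* X) t * sin (u * X t))).
Proof.
move=> iX iXX X0; have mX := integrable_measurable iX.
have i1X : integ ((fun=> 1) \* X).
  by rewrite (_ : _ \* _ = X)//; apply/funext => t /=; rewrite mul1r.
split.
- move=> u; have := is_derive_cos_moment u mX integrable_cst1 i1X.
  by under [X in - X]eq_Rintegral do rewrite mul1r.
- move=> u; have := is_derive_sin_moment u mX integrable_cst1 i1X.
  by under [X in is_derive _ _ _ X]eq_Rintegral do rewrite mul1r.
- by move=> u; exact: is_derive_cos_moment.
- by move=> u; exact: is_derive_sin_moment.
- under eq_Rintegral do rewrite mul0r cos0 mulr1.
  exact: Rintegral_probability_cst.
- under eq_Rintegral do rewrite mul0r sin0 mulr0.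
  exact: Rintegral_probability_cst.
- by under eq_Rintegral do rewrite mul0r cos0 mulr1.
- under eq_Rintegral do rewrite mul0r sin0 mulr0.
  exact: Rintegral_probability_cst.
Qed.

(** Real part of the factorization of E(p(X) q(W) e^(iu(X+W))) into E(p(X) e^(iuX)) and E(q(W)
    e^(iuW)); the next lemma is the imaginary part. *)
Lemma Rintegral_mul_cosD X W (p q : R -> R) (u : R) :
  indep P X W -> measurable_fun setT X -> measurable_fun setT W ->
  measurable_fun setT p -> measurable_fun setT q ->
  integ (p \o X) -> integ (q \o W) ->
  \int[P]_t (p (X t) * q (W t) * cos (u * (X t + W t))) =
  (\int[P]_t (p (X t) * cos (u * X t))) * (\int[P]_t (q (W t) * cos (u * W t))) -
  (\int[P]_t (p (X t) * sin (u * X t))) * (\int[P]_t (q (W t) * sin (u * W t))).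
Proof.
move=> XW mX mW mp mq ip iq.
have pc := integrable_mulr_le1 ip (measurable_cos_scale u mX) (fun=> normr_cos_le1 _).
have ps := integrable_mulr_le1 ip (measurable_sin_scale u mX) (fun=> normr_sin_le1 _).
have qc := integrable_mulr_le1 iq (measurable_cos_scale u mW) (fun=> normr_cos_le1 _).
have qs := integrable_mulr_le1 iq (measurable_sin_scale u mW) (fun=> normr_sin_le1 _).
have icc : indep P (fun t => p (X t) * cos (u * X t)) (fun t => q (W t) * cos (u * W t)).
  apply: (indep_comp (h := fun x => p x * cos (u * x))
    (k := fun x => q x * cos (u * x))) => //.
    by apply: measurable_funM => //; exact: measurable_cos_scale.
  by apply: measurable_funM => //; exact: measurable_cos_scale.
have iss : indep P (fun t => p (X t) * sin (u * X t)) (fun t => q (W t) * sin (u * W t)).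
  apply: (indep_comp (h := fun x => p x * sin (u * x))
    (k := fun x => q x * sin (u * x))) => //.
    by apply: measurable_funM => //; exact: measurable_sin_scale.
  by apply: measurable_funM => //; exact: measurable_sin_scale.
have [ic Ec] := indep_expectationM pc qc icc.
have [is_ Es] := indep_expectationM ps qs iss.
rewrite -Ec -Es -RintegralB//; apply: eq_Rintegral => t _.
by rewrite mulrDr cosD /=; ring.
Qed.

Lemma Rintegral_mul_sinD X W (p q : R -> R) (u : R) :
  indep P X W -> measurable_fun setT X -> measurable_fun setT W ->
  measurable_fun setT p -> measurable_fun setT q ->
  integ (p \o X) -> integ (q \o W) ->
  \int[P]_t (p (X t) * q (W t) * sin (u * (X t + W t))) =
  (\int[P]_t (p (X t) * cos (u * X t))) * (\int[P]_t (q (W t) * sin (u * W t))) +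
  (\int[P]_t (p (X t) * sin (u * X t))) * (\int[P]_t (q (W t) * cos (u * W t))).
Proof.
move=> XW mX mW mp mq ip iq.
have pc := integrable_mulr_le1 ip (measurable_cos_scale u mX) (fun=> normr_cos_le1 _).
have ps := integrable_mulr_le1 ip (measurable_sin_scale u mX) (fun=> normr_sin_le1 _).
have qc := integrable_mulr_le1 iq (measurable_cos_scale u mW) (fun=> normr_cos_le1 _).
have qs := integrable_mulr_le1 iq (measurable_sin_scale u mW) (fun=> normr_sin_le1 _).
have ics : indep P (fun t => p (X t) * cos (u * X t)) (fun t => q (W t) * sin (u * W t)).
  apply: (indep_comp (h := fun x => p x * cos (u * x))
    (k := fun x => q x * sin (u * x))) => //.
    by apply: measurable_funM => //; exact: measurable_cos_scale.
  by apply: measurable_funM => //; exact: measurable_sin_scale.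
have isc : indep P (fun t => p (X t) * sin (u * X t)) (fun t => q (W t) * cos (u * W t)).
  apply: (indep_comp (h := fun x => p x * sin (u * x))
    (k := fun x => q x * cos (u * x))) => //.
    by apply: measurable_funM => //; exact: measurable_sin_scale.
  by apply: measurable_funM => //; exact: measurable_cos_scale.
have [ic Ec] := indep_expectationM pc qs ics.
have [is_ Es] := indep_expectationM ps qc isc.
rewrite -Ec -Es -RintegralD//; apply: eq_Rintegral => t _.
by rewrite mulrDr sinD /=; ring.
Qed.

(* [e1], [e2], [e3] are the relations [c phi1 chi0 = phi0 chi1],
   [c^2 phi2 chi0 - 2 c phi1 chi1 + phi0 chi2 = c (c + 1) v phi0 chi0] and
   [c phi2 chi0 + (c - 1) phi1 chi1 - phi0 chi2 = 0] between complex numbers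
   [phik = ak + i bk] and [chik = pk + i qk], separated into real and imaginary
   parts; eliminating, [phi0 phi2 - phi1^2 = v phi0^2] and
   [chi0 chi2 - chi1^2 = c v chi0^2]. *)
Lemma riccati_elimination (c v a0 b0 a1 b1 a2 b2 p0 q0 p1 q1 p2 q2 : R) :
  0 < c -> a0 ^+ 2 + b0 ^+ 2 != 0 -> p0 ^+ 2 + q0 ^+ 2 != 0 ->
  c * (a1 * p0 - b1 * q0) - (a0 * p1 - b0 * q1) = 0 ->
  c * (a1 * q0 + b1 * p0) - (a0 * q1 + b0 * p1) = 0 ->
  c ^+ 2 * (a2 * p0 - b2 * q0) - 2 * c * (a1 * p1 - b1 * q1) +
    (a0 * p2 - b0 * q2) = c * (c + 1) * v * (a0 * p0 - b0 * q0) ->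
  c ^+ 2 * (a2 * q0 + b2 * p0) - 2 * c * (a1 * q1 + b1 * p1) +
    (a0 * q2 + b0 * p2) = c * (c + 1) * v * (a0 * q0 + b0 * p0) ->
  c * (a2 * p0 - b2 * q0) + (c - 1) * (a1 * p1 - b1 * q1) -
    (a0 * p2 - b0 * q2) = 0 ->
  c * (a2 * q0 + b2 * p0) + (c - 1) * (a1 * q1 + b1 * p1) -
    (a0 * q2 + b0 * p2) = 0 ->
  (a0 * a2 - b0 * b2 - a1 ^+ 2 + b1 ^+ 2 = v * (a0 ^+ 2 - b0 ^+ 2) /\
   a0 * b2 + b0 * a2 - a1 * b1 *+ 2 = v * (a0 * b0) *+ 2) /\
  (p0 * p2 - q0 * q2 - p1 ^+ 2 + q1 ^+ 2 = (c * v) * (p0 ^+ 2 - q0 ^+ 2) /\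
   p0 * q2 + q0 * p2 - p1 * q1 *+ 2 = (c * v) * (p0 * q0) *+ 2).
Proof.
move=> c0 ab pq.
set e1r := (X in X = 0 -> _) => E1r; set e1i := (X in X = 0 -> _) => E1i.
move=> /eqP; rewrite -subr_eq0; set e2r := (X in X == 0) => /eqP E2r.
move=> /eqP; rewrite -subr_eq0; set e2i := (X in X == 0) => /eqP E2i.
set e3r := (X in X = 0 -> _) => E3r; set e3i := (X in X = 0 -> _) => E3i.
(* Cancels a nonzero real factor [r] and a nonzero complex factor x + i y, the latter by multiplying
   with its conjugate. *)
have unmul (r x y kr ki : R) : r != 0 -> x ^+ 2 + y ^+ 2 != 0 ->
    r * (x * kr - y * ki) = 0 -> r * (x * ki + y * kr) = 0 -> kr = 0 /\ ki = 0.
  move=> r0 xy /eqP; rewrite mulf_eq0 (negbTE r0) /= => /eqP h1.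
  move=> /eqP; rewrite mulf_eq0 (negbTE r0) /= => /eqP h2.
  split; apply/(mulfI xy); rewrite mulr0.
    transitivity (x * (x * kr - y * ki) + y * (x * ki + y * kr)); first by ring.
    by rewrite h1 h2 !mulr0 addr0.
  transitivity (x * (x * ki + y * kr) - y * (x * kr - y * ki)); first by ring.
  by rewrite h1 h2 !mulr0 subr0.
have c1 : c + 1 != 0 by rewrite gt_eqF// addr_gt0.
have cc1 : c * (c + 1) != 0 by rewrite mulf_neq0// gt_eqF.
have [kr ki] : a0 * a2 - b0 * b2 - a1 ^+ 2 + b1 ^+ 2 - v * (a0 ^+ 2 - b0 ^+ 2) = 0 /\
   a0 * b2 + b0 * a2 - a1 * b1 *+ 2 - v * (a0 * b0) *+ 2 = 0.
  (* In complex form, with e1, e2, e3 the left sides minus the right sides: phi0 (e2 + e3) - (c + 1)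
     phi1 e1 = c (c + 1) chi0 (phi0 phi2 - phi1^2 - v phi0^2). *)
  apply: (unmul _ p0 q0 _ _ cc1 pq).
    transitivity (a0 * (e2r + e3r) - b0 * (e2i + e3i)
                  - (c + 1) * (a1 * e1r - b1 * e1i)).
      by rewrite /e1r /e1i /e2r /e2i /e3r /e3i; ring.
    by rewrite E1r E1i E2r E2i E3r E3i; ring.
  transitivity (a0 * (e2i + e3i) + b0 * (e2r + e3r)
                - (c + 1) * (a1 * e1i + b1 * e1r)).
    by rewrite /e1r /e1i /e2r /e2i /e3r /e3i; ring.
  by rewrite E1r E1i E2r E2i E3r E3i; ring.
have [lr li] : p0 * p2 - q0 * q2 - p1 ^+ 2 + q1 ^+ 2 - c * v * (p0 ^+ 2 - q0 ^+ 2) = 0 /\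
   p0 * q2 + q0 * p2 - p1 * q1 *+ 2 - c * v * (p0 * q0) *+ 2 = 0.
  (* Likewise chi0 (e2 - c e3) + (c + 1) chi1 e1 = (c + 1) phi0 (chi0 chi2 - chi1^2 - c v
     chi0^2). *)
  apply: (unmul _ a0 b0 _ _ c1 ab).
    transitivity (p0 * (e2r - c * e3r) - q0 * (e2i - c * e3i)
                  + (c + 1) * (p1 * e1r - q1 * e1i)).
      by rewrite /e1r /e1i /e2r /e2i /e3r /e3i; ring.
    by rewrite E1r E1i E2r E2i E3r E3i; ring.
  transitivity (p0 * (e2i - c * e3i) + q0 * (e2r - c * e3r)
                + (c + 1) * (p1 * e1i + q1 * e1r)).
    by rewrite /e1r /e1i /e2r /e2i /e3r /e3i; ring.
  by rewrite E1r E1i E2r E2i E3r E3i; ring.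
by split; split; apply/eqP; rewrite -subr_eq0; apply/eqP.
Qed.

Variables X W Z : T -> R.
Hypotheses (iX : integ X) (iXX : integ (X \* X)) (X0 : \int[P]_t X t = 0).
Hypotheses (iW : integ W) (iWW : integ (W \* W)) (W0 : \int[P]_t W t = 0).
Hypotheses (iZ : integ Z) (iZZ : integ (Z \* Z)) (Z0 : \int[P]_t Z t = 0).
Hypothesis XW : indep P X W.
(** Independence of [Z] from the pair (X, W), phrased through real functions of the pair because
    [indep] compares real-valued functions only. *)
Hypothesis Z_XW : forall f : R * R -> R, measurable_fun setT f ->
  indep P Z (fun t => f (X t, W t)).
Variable c : R.
Hypotheses (c0 : 0 < c)
  (cE : c * \int[P]_t (X t * X t) = \int[P]_t (W t * W t)).
Let U t := X t + W t.
Let V t := c * X t - W t + Z t.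
Hypothesis UV : indep P U V.

Let iXW : integ (X \* W). Proof. by have [] := indep_expectationM iX iW XW. Qed.

(** * Moments against a bounded test function of U: a cosine, a sine or the constant 1 *)

Section test_function.
Variable tau : R -> R.
Hypotheses (mtau : measurable_fun setT tau) (tau1 : forall x, `|tau x| <= 1).
Let S t := tau (X t + W t).
Let mX := integrable_measurable iX.
Let mW := integrable_measurable iW.
Let mS : measurable_fun setT S.
Proof. exact: (measurableT_comp mtau (measurable_funD mX mW)). Qed.
Let iS f : integ f -> integ (f \* S).
Proof. by move=> iF; exact: (integrable_mulr_le1 iF mS (fun=> tau1 _)). Qed.
Let iS1 : integ S.
Proof.
have := iS integrable_cst1.
by rewrite (_ : _ \* _ = S)//; apply/funext => t /=; rewrite mul1r.
Qed.
Let mid : measurable_fun setT (@idfun R). Proof. exact: measurable_id. Qed.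
Let msq : measurable_fun setT (fun x : R => x * x).
Proof. exact: measurable_funM. Qed.
Let VU : indep P V U. Proof. exact: indep_sym. Qed.
Let msum : measurable_fun setT (fun z : R * R => z.1 + z.2).
Proof. exact: measurable_funD. Qed.
Let mtausum : measurable_fun setT (fun z : R * R => tau (z.1 + z.2)).
Proof. exact: measurableT_comp. Qed.
Let iU : integ (fun t => X t + W t).
Proof. exact: integrable_addr. Qed.
Let iV0 : integ (fun t => c * X t - W t).
Proof.
by apply: eqfun_integrable (integrable_lin3 c (-1) 0 iX iW iX) => t; ring.
Qed.
Let iV : integ V.
Proof.
apply: eqfun_integrable (integrable_lin3 c (-1) 1 iX iW iZ) => t.
by rewrite /V; ring.
Qed.
Let V_0 : \int[P]_t V t = 0.
Proof.
have := Rintegral_lin3 c (-1) 1 iX iW iZ; rewrite X0 W0 Z0 !mulr0 !addr0 => <-.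
by apply: eq_Rintegral => t _; rewrite /V; ring.
Qed.

(** This is E(V tau(U)) = E(V) E(tau(U)) = 0, from which Z drops out, being centered and independent
    of (X, W). *)
Lemma test_first_moment :
  c * \int[P]_t (X t * S t) - \int[P]_t (W t * S t) = 0.
Proof.
have VS : indep P V S.
  exact: (indep_comp mid mtau VU).
have [_ EVS] := indep_expectationM iV iS1 VS.
have [iZS EZS] := indep_expectationM iZ iS1 (Z_XW mtausum).
have := Rintegral_lin3 c (-1) 1 (iS iX) (iS iW) iZS.
rewrite EZS Z0 mul0r mulr0 addr0 mulN1r => <-.
rewrite -[RHS](mul0r (\int[P]_t S t)) -{1}V_0 -EVS.
by apply: eq_Rintegral => t _; rewrite /= /V; ring.
Qed.

Lemma test_second_moment : \int[P]_t (V t * V t * S t) =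
  c ^+ 2 * \int[P]_t ((X \* X) t * S t) - 2 * c * \int[P]_t ((X \* W) t * S t) +
  \int[P]_t ((W \* W) t * S t) + \int[P]_t (Z t * Z t) * \int[P]_t S t.
Proof.
have [iZZS EZZS] : integ ((Z \* Z) \* S) /\
    \int[P]_t ((Z \* Z) t * S t) = \int[P]_t (Z t * Z t) * \int[P]_t S t.
  apply: indep_expectationM => //.
  exact: (indep_comp msq mid (Z_XW mtausum)).
have [iZVS EZVS] : integ (Z \* (fun t => (c * X t - W t) * S t)) /\
    \int[P]_t (Z t * ((c * X t - W t) * S t)) =
    \int[P]_t Z t * \int[P]_t ((c * X t - W t) * S t).
  apply: indep_expectationM => //; first exact: iS.
  apply: (Z_XW (f := fun z => (c * z.1 - z.2) * tau (z.1 + z.2))).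
  apply: measurable_funM => //; apply: measurable_funB => //.
  exact: measurable_funM.
rewrite -EZZS.
have := Rintegral_lin3 2 1 0 iZVS iZZS iZZS.
rewrite EZVS Z0 mul0r mulr0 add0r mul1r mul0r addr0 => <-.
have iR := integrable_lin3 2 1 0 iZVS iZZS iZZS.
have iL := integrable_lin3 (c ^+ 2) (- (2 * c)) 1 (iS iXX) (iS iXW) (iS iWW).
have := Rintegral_lin3 (c ^+ 2) (- (2 * c)) 1 (iS iXX) (iS iXW) (iS iWW).
rewrite mulNr mul1r => <-.
rewrite -RintegralD//; apply: eq_Rintegral => t _.
by rewrite /= /V; ring.
Qed.

Lemma test_second_moment_indep :
  \int[P]_t (V t * V t * S t) = \int[P]_t (V t * V t) * \int[P]_t S t.
Proof.
have iVV : integ (V \* V).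
  have [iZV _] : integ (Z \* (fun t => c * X t - W t)) /\
    \int[P]_t (Z t * (c * X t - W t)) =
    \int[P]_t Z t * \int[P]_t (c * X t - W t).
    apply: indep_expectationM => //.
    apply: (Z_XW (f := fun z => c * z.1 - z.2)).
    by apply: measurable_funB => //; exact: measurable_funM.
  have i1 := integrable_lin3 2 1 0 iZV iZZ iZZ.
  have i2 := integrable_lin3 (c ^+ 2) (- (2 * c)) 1 iXX iXW iWW.
  apply: eqfun_integrable (integrable_lin3 1 1 0 i1 i2 i2) => t.
  by rewrite /V /=; ring.
by have [] := indep_expectationM iVV iS1 (indep_comp msq mtau VU).
Qed.

(** U tau(U) is again a function of U, so E(V U tau(U)) = 0; expand V U = c X^2 + (c - 1) X W - W^2
    + Z U. *)
Lemma test_mixed_moment :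
  c * \int[P]_t ((X \* X) t * S t) + (c - 1) * \int[P]_t ((X \* W) t * S t) -
  \int[P]_t ((W \* W) t * S t) = 0.
Proof.
have [_ EVUS] : integ (V \* (fun t => U t * S t)) /\
    \int[P]_t (V t * (U t * S t)) = \int[P]_t V t * \int[P]_t (U t * S t).
  apply: indep_expectationM => //; first exact: iS.
  by apply: (indep_comp mid (k := fun x => x * tau x) _ VU); exact: measurable_funM.
have [iZUS EZUS] : integ (Z \* (fun t => U t * S t)) /\
    \int[P]_t (Z t * (U t * S t)) = \int[P]_t Z t * \int[P]_t (U t * S t).
  apply: indep_expectationM => //; first exact: iS.
  apply: (Z_XW (f := fun z => (z.1 + z.2) * tau (z.1 + z.2))).
  exact: measurable_funM.
rewrite -[RHS](mul0r (\int[P]_t (U t * S t))) -{1}V_0 -EVUS.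
have := Rintegral_lin3 c (c - 1) (-1) (iS iXX) (iS iXW) (iS iWW).
rewrite mulN1r => <-.
have i1 := integrable_lin3 c (c - 1) (-1) (iS iXX) (iS iXW) (iS iWW).
have := RintegralD measurableT i1 iZUS.
rewrite EZUS Z0 mul0r addr0 => <-.
by apply: eq_Rintegral => t _; rewrite /= /V /U; ring.
Qed.

End test_function.

(** The expansion of the second moment at tau = 1, where [cE] turns c^2 var X + var W into c (c + 1)
    var X. *)
Let VV : \int[P]_t (V t * V t) =
  c * (c + 1) * \int[P]_t (X t * X t) + \int[P]_t (Z t * Z t).
Proof.
have m1 : measurable_fun [set: R] (cst (1 : R)) by exact: measurable_cst.
have := @test_second_moment (fun=> 1) m1 (fun=> _).
under eq_Rintegral do rewrite mulr1.
move=> ->; last by rewrite normr1.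
under eq_Rintegral do rewrite mulr1.
under [X in _ - _ * X]eq_Rintegral do rewrite mulr1.
under [X in _ - _ + X + _]eq_Rintegral do rewrite mulr1.
rewrite Rintegral_probability_cst mulr1.
have [_ ->] := indep_expectationM iX iW XW.
by rewrite -cE X0; ring.
Qed.

Lemma two_variable_darmois_skitovich t : 0 <= t ->
  \int[P]_s cos (t * X s) = expR (- (\int[P]_s (X s * X s)) * t ^+ 2 / 2) /\
  \int[P]_s sin (t * X s) = 0.
Proof.
move=> t0.
have mX := integrable_measurable iX; have mW := integrable_measurable iW.
have SX := trig_system_moments iX iXX X0.
have SW := trig_system_moments iW iWW W0.
have one (g : T -> R) : \int[P]_s g s = \int[P]_s (1 * g s).
  by apply: eq_Rintegral => s _; rewrite mul1r.
rewrite [in X in X /\ _]one [in X in _ /\ X]one.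
apply: (trig_system_pair_gaussian (v := \int[P]_s (X s * X s))
  (w := c * \int[P]_s (X s * X s)) SX SW _ t0) => u phi0 chi0.
have mid : measurable_fun setT (@idfun R) by exact: measurable_id.
have mc : measurable_fun setT (fun x : R => cos (u * x)).
  exact: (measurable_cos_scale u mid).
have ms : measurable_fun setT (fun x : R => sin (u * x)).
  exact: (measurable_sin_scale u mid).
have c1 (x : R) : `|cos (u * x)| <= 1 by exact: normr_cos_le1.
have s1 (x : R) : `|sin (u * x)| <= 1 by exact: normr_sin_le1.
have m1 : measurable_fun [set: R] (cst (1 : R)) by exact: measurable_cst.
have m2 : measurable_fun setT (fun x : R => x * x) by exact: measurable_funM.
have i1 f : integ ((fun=> 1 : R) \o f) by exact: integrable_cst1.
have C (p q : R -> R) := @Rintegral_mul_cosD X W p q u XW mX mW.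
have S (p q : R -> R) := @Rintegral_mul_sinD X W p q u XW mX mW.
(* The two digits are the degrees in [X] and in [W]: [Cmn] and [Smn] are the real and imaginary
   parts of phim chin. *)
have C10 := C _ _ mid m1 iX (i1 W); have S10 := S _ _ mid m1 iX (i1 W).
have C01 := C _ _ m1 mid (i1 X) iW; have S01 := S _ _ m1 mid (i1 X) iW.
have C20 := C _ _ m2 m1 iXX (i1 W); have S20 := S _ _ m2 m1 iXX (i1 W).
have C02 := C _ _ m1 m2 (i1 X) iWW; have S02 := S _ _ m1 m2 (i1 X) iWW.
have C11 := C _ _ mid mid iX iW; have S11 := S _ _ mid mid iX iW.
have C00 := C _ _ m1 m1 (i1 X) (i1 W); have S00 := S _ _ m1 m1 (i1 X) (i1 W).
have simp1 (h g : T -> R) : \int[P]_t (h t * 1 * g t) = \int[P]_t (h t * g t).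
  by apply: eq_Rintegral => s _; rewrite mulr1.
have simp2 (h g : T -> R) : \int[P]_t (1 * h t * g t) = \int[P]_t (h t * g t).
  by apply: eq_Rintegral => s _; rewrite mul1r.
have simp3 (g : T -> R) : \int[P]_t (1 * 1 * g t) = \int[P]_t (g t).
  by apply: eq_Rintegral => s _; rewrite !mul1r.
rewrite /= simp1 in C10; rewrite /= simp1 in S10.
rewrite /= simp1 in C20; rewrite /= simp1 in S20.
rewrite /= simp2 in C01; rewrite /= simp2 in S01.
rewrite /= simp2 in C02; rewrite /= simp2 in S02.
rewrite /= simp3 in C00; rewrite /= simp3 in S00.
(* E(Z^2) E(tau(U)) occurs on both sides and cancels, so that the law of [Z] disappears from the
   relations. *)
have E2 (tau : R -> R) (mt : measurable_fun setT tau) (t1 : forall x : R, `|tau x| <= 1) :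
    c ^+ 2 * \int[P]_t (X t * X t * tau (X t + W t)) -
    2 * c * \int[P]_t (X t * W t * tau (X t + W t)) +
    \int[P]_t (W t * W t * tau (X t + W t)) =
    c * (c + 1) * \int[P]_s (X s * X s) * \int[P]_t tau (X t + W t).
  have := test_second_moment mt t1; rewrite test_second_moment_indep// VV.
  by rewrite mulrDl => /addIr ->.
apply: riccati_elimination => //.
- by rewrite -C10 -C01; exact: (test_first_moment mc c1).
- by rewrite -S10 -S01; exact: (test_first_moment ms s1).
- by rewrite -C20 -C11 -C02 -C00; exact: (E2 _ mc c1).
- by rewrite -S20 -S11 -S02 -S00; exact: (E2 _ ms s1).
- by rewrite -C20 -C11 -C02; exact: (test_mixed_moment mc c1).
- by rewrite -S20 -S11 -S02; exact: (test_mixed_moment ms s1).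
Qed.

End darmois_skitovich.

(** * Uniqueness of characteristic functions *)

Section threshold_polynomials.
Variable R : realType.

(* Tends to the indicator of [z <= 1/2] on [0, 1]; the exponent is [2^(2^j) / 2^j]
   and not [2^(2^j)] in order to have the limit 1 at [z = 1/2] too. *)
Definition threshold (j : nat) (z : R) : R :=
  (1 - z ^+ (2 ^ j)) ^+ (2 ^ (2 ^ j - j)).

Lemma bernoulli_le (u : R) n : 0 <= u <= 1 -> 1 - u *+ n <= (1 - u) ^+ n.
Proof.
move=> /andP[u0 u1]; elim: n => [|n IH]; first by rewrite mulr0n subr0 expr0.
have uu : 0 <= 1 - u by rewrite subr_ge0.
rewrite exprS; apply: le_trans (ler_wpM2l uu IH).
rewrite mulrSr -subr_ge0.
have -> : (1 - u) * (1 - u *+ n) - (1 - (u *+ n + u)) = u * (u *+ n) by ring.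
by rewrite mulr_ge0// mulrn_wge0.
Qed.

(** Bernoulli bounds 1 + n u by (1 + u)^n, and (1 - u)^n (1 + u)^n = (1 - u^2)^n <= 1. This bounds
    [threshold] from above by 1 / (1 + n u). *)
Lemma bernoulli_ge (u : R) n : 0 <= u <= 1 -> (1 - u) ^+ n * (1 + u *+ n) <= 1.
Proof.
move=> /andP[u0 u1].
have uu : 0 <= 1 - u by rewrite subr_ge0.
have pu : 1 + u *+ n <= (1 + u) ^+ n.
  elim: n => [|n IH]; first by rewrite mulr0n addr0 expr0.
  have u1' : 0 <= 1 + u by rewrite addr_ge0.
  rewrite exprS; apply: le_trans (ler_wpM2l u1' IH).
  rewrite mulrSr -subr_ge0.
  have -> : (1 + u) * (1 + u *+ n) - (1 + (u *+ n + u)) = u * (u *+ n) by ring.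
  by rewrite mulr_ge0// mulrn_wge0.
apply: (@le_trans _ _ ((1 - u) ^+ n * (1 + u) ^+ n)).
  by rewrite ler_wpM2l// exprn_ge0.
rewrite -exprMn exprn_ile1//; first by rewrite mulr_ge0// addr_ge0.
have -> : (1 - u) * (1 + u) = 1 - u ^+ 2 by ring.
by rewrite lerBlDr lerDl sqr_ge0.
Qed.

Lemma threshold01 j (z : R) : 0 <= z <= 1 -> 0 <= threshold j z <= 1.
Proof.
move=> /andP[z0 z1].
have zn0 : 0 <= z ^+ (2 ^ j) by exact: exprn_ge0.
have zn1 : z ^+ (2 ^ j) <= 1 by by rewrite exprn_ile1.
rewrite /threshold exprn_ge0 ?subr_ge0//= exprn_ile1 ?subr_ge0//.
by rewrite lerBlDr lerDl.
Qed.

Lemma threshold_cvg (z : R) : 0 <= z <= 1 ->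
  threshold j z @[j --> \oo] --> (((z <= 2^-1)%R : bool)%:R : R).
Proof.
move=> z01; have /andP[z0 z1] := z01.
have jj (j : nat) : (j <= 2 ^ j)%N by exact/ltnW/ltn_expl.
have half0 : (2^-1 : R) ^+ j @[j --> \oo] --> (0 : R).
  by apply: cvg_expr; rewrite ger0_norm ?invr_ge0// invf_lt1// ltr1n.
have zn01 (j : nat) : 0 <= z ^+ (2 ^ j) <= 1 by rewrite exprn_ge0//= exprn_ile1.
have [zh|zh] := leP z 2^-1.
  apply: (@squeeze_cvgr _ _ _ _ (fun j => 1 - (2^-1 : R) ^+ j) (fun=> 1)).
  - apply: nearW => j; have /andP[_ -> /[!andbT]] := threshold01 j z01.
    apply: le_trans (bernoulli_le _ (zn01 j)).
    rewrite lerD2l lerN2 -[_ ^+ _ *+ _]mulr_natr natrX.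
    apply: (@le_trans _ _ (2^-1 ^+ (2 ^ j) * 2 ^+ (2 ^ j - j))).
      by rewrite ler_wpM2r ?exprn_ge0// lerXn2r// nnegrE ?invr_ge0.
    rewrite -{1}(subnK (jj j)) exprD mulrAC -exprMn mulVf// expr1n mul1r.
    exact: lexx.
  - rewrite -[X in _ --> X]subr0; apply: cvgB => //; exact: cvg_cst.
  - exact: cvg_cst.
pose h := 2 * z - 1.
have h0 : 0 < h by rewrite /h; lra.
have zE : z = (1 + h) / 2 by rewrite /h; lra.
rewrite -cvg_shiftS.
apply: (@squeeze_cvgr _ _ _ _ (fun=> 0) (fun j => 2 / h ^+ 2 * (2^-1 : R) ^+ j)).
- apply: nearW => j; have /andP[-> _ /=] := threshold01 j.+1 z01.
  have := bernoulli_ge (2 ^ (2 ^ j.+1 - j.+1)) (zn01 j.+1).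
  rewrite -/(threshold j.+1 z) -[_ ^+ _ *+ _]mulr_natr natrX.
  set w := _ * _ ^+ _.
  have wE : w = (1 + h) ^+ (2 ^ j.+1) / 2 ^+ j.+1.
    rewrite /w zE expr_div_n -!mulrA; congr (_ * _).
    rewrite -{1}(subnK (jj j.+1)) exprD invfM mulrAC.
    by rewrite mulVf ?mul1r// expf_eq0 andbC pnatr_eq0.
  (* Half of the exponent 2^(j+1) goes through Bernoulli and the result is squared: (h 2^j)^2
     outgrows the denominator 2^(j+1), while Bernoulli applied to the full exponent would only give
     the constant h. *)
  have wlb : h ^+ 2 * 2 ^+ j / 2 <= w.
    rewrite wE expnS mulnC exprM.
    have hb : h * 2 ^+ j <= (1 + h) ^+ (2 ^ j).
      rewrite -natrX mulr_natr.
      elim: (2 ^ j)%N => [|n IH]; first by rewrite mulr0n expr0.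
      have : 1 <= (1 + h) ^+ n by rewrite exprn_ege1// lerDl ltW.
      rewrite exprS mulrDl mul1r mulrSr => h1; apply: lerD => //.
      by rewrite ler_peMr// ltW.
    have hb0 : 0 <= h * 2 ^+ j by rewrite mulr_ge0 ?exprn_ge0 ?ltW.
    have := lerXn2r 2 (hb0 : _ \is Num.nneg) (le_trans hb0 hb : _ \is Num.nneg) hb.
    move=> hb2.
    have p0 : 0 <= (2 ^+ j.+1 : R)^-1 by rewrite invr_ge0 exprn_ge0.
    apply: le_trans (ler_wpM2r p0 hb2).
    rewrite [2 ^+ j.+1]exprS le_eqVlt; apply/orP; left; apply/eqP.
    have : (2 ^+ j : R) != 0 by rewrite expf_neq0.
    by move: (2 ^+ j) => a a0; field.
  set th := threshold _ _ => hth.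
  have w0 : 0 < h ^+ 2 * 2 ^+ j / 2.
    by rewrite divr_gt0// mulr_gt0 ?exprn_gt0.
  have th0 : 0 <= th by have /andP[] := threshold01 j.+1 z01.
  have -> : 2 / h ^+ 2 * 2^-1 ^+ j = (h ^+ 2 * 2 ^+ j / 2)^-1.
    rewrite exprVn.
    have : (2 ^+ j : R) != 0 by rewrite expf_neq0.
    have : h != 0 by rewrite gt_eqF.
    by move: (2 ^+ j) => a hn0 an0; field; rewrite hn0 an0.
  rewrite -[leRHS]mul1r ler_pdivlMr//.
  apply: le_trans hth; rewrite ler_wpM2l//.
  by apply: le_trans wlb _; rewrite lerDr.
- exact: cvg_cst.
- rewrite (_ : false%:R = 2 / h ^+ 2 * 0); last by rewrite mulr0.
  by apply: cvgM => //; exact: cvg_cst.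
Qed.

End threshold_polynomials.

Section characteristic_function_uniqueness.
Context (R : realType) (mu nu : probability R R).
Implicit Types f g : R -> R.

Definition same_integral f : Prop := \int[mu]_x f x = \int[nu]_x f x.

(** Testing against all frequencies makes the class stable under multiplication by sines and
    cosines, by the product formulas; hence it contains all trigonometric polynomials. Frequency 0
    gives back [same_integral]. *)
Definition same_trig_integrals f : Prop :=
  [/\ measurable_fun setT f, exists M, forall x, `|f x| <= M
    & forall t, same_integral (fun x => f x * cos (t * x)) /\
                same_integral (fun x => f x * sin (t * x))].

Lemma eqfun_same_integral f g : f =1 g -> same_integral f -> same_integral g.
Proof. by move=> /funext ->. Qed.

Lemma eqfun_same_trig f g :
  f =1 g -> same_trig_integrals f -> same_trig_integrals g.
Proof. by move=> /funext ->. Qed.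

Lemma bounded_integrable (P : probability R R) f M : measurable_fun setT f ->
  (forall x, `|f x| <= M) -> P.-integrable setT (EFin \o f).
Proof.
move=> mf fM; apply: measurable_bounded_integrable => //.
  by rewrite ltey_eq fin_num_measure.
exists M; split; first exact: num_real.
by move=> x Mx y _; apply: le_trans (fM y) _; exact: ltW.
Qed.

Lemma same_integral_lin (a b : R) f g (M N : R) :
  measurable_fun setT f -> measurable_fun setT g ->
  (forall x, `|f x| <= M) -> (forall x, `|g x| <= N) ->
  same_integral f -> same_integral g ->
  same_integral (fun x => a * f x + b * g x).
Proof.
move=> mf mg fM gN sf sg; rewrite /same_integral.
have lin (P : probability R R) : \int[P]_x (a * f x + b * g x) =
    a * \int[P]_x f x + b * \int[P]_x g x.
  have iF := bounded_integrable P mf fM; have iG := bounded_integrable P mg gN.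
  have := Rintegral_lin3 a b 0 iF iG iG; rewrite mul0r addr0 => <-.
  by apply: eq_Rintegral => x _; rewrite mul0r addr0.
by rewrite !lin sf sg.
Qed.

Let mcos (t : R) : measurable_fun [set: R] (fun x => cos (t * x)).
Proof. exact: (measurable_cos_scale t (@measurable_id _ _ _)). Qed.

Let msin (t : R) : measurable_fun [set: R] (fun x => sin (t * x)).
Proof. exact: (measurable_sin_scale t (@measurable_id _ _ _)). Qed.

Lemma normrM_le1 (a b M : R) : `|a| <= M -> `|b| <= 1 -> `|a * b| <= M.
Proof.
by move=> aM b1; rewrite normrM; apply: le_trans aM; rewrite ler_piMr.
Qed.

Lemma same_trig_lin (a b : R) f g : same_trig_integrals f ->
  same_trig_integrals g -> same_trig_integrals (fun x => a * f x + b * g x).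
Proof.
move=> [mf [M fM] sf] [mg [N gN] sg]; split.
- by apply: measurable_funD; apply: measurable_funM.
- exists (`|a| * M + `|b| * N) => x; apply: le_trans (ler_normD _ _) _.
  by rewrite !normrM lerD// ler_wpM2l.
- move=> t; split.
    have fc x : `|f x * cos (t * x)| <= M by exact: normrM_le1 (normr_cos_le1 _).
    have gc x : `|g x * cos (t * x)| <= N by exact: normrM_le1 (normr_cos_le1 _).
    apply: eqfun_same_integral (same_integral_lin a b (measurable_funM mf (mcos t))
      (measurable_funM mg (mcos t)) fc gc (sf t).1 (sg t).1) => x /=.
    ring.
  have fs x : `|f x * sin (t * x)| <= M by exact: normrM_le1 (normr_sin_le1 _).
  have gs x : `|g x * sin (t * x)| <= N by exact: normrM_le1 (normr_sin_le1 _).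
  apply: eqfun_same_integral (same_integral_lin a b (measurable_funM mf (msin t))
    (measurable_funM mg (msin t)) fs gs (sf t).2 (sg t).2) => x /=.
  ring.
Qed.

Lemma same_trig_mul_cos (th : R) f : same_trig_integrals f ->
  same_trig_integrals (fun x => f x * cos (th * x)).
Proof.
move=> [mf [M fM] sf]; split.
- exact: measurable_funM.
- by exists M => x; apply: normrM_le1 => //; exact: normr_cos_le1.
- have bc t x : `|f x * cos (t * x)| <= M.
    by apply: normrM_le1 => //; exact: normr_cos_le1.
  have bs t x : `|f x * sin (t * x)| <= M.
    by apply: normrM_le1 => //; exact: normr_sin_le1.
  move=> t; split.
    apply: eqfun_same_integral (same_integral_lin 2^-1 2^-1 (measurable_funM mf (mcos (t + th)))
      (measurable_funM mf (mcos (t - th))) (bc _) (bc _) (sf _).1 (sf _).1) => x /=.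
    by rewrite [(t + th) * x]mulrDl [(t - th) * x]mulrBl cosD cosB; field.
  apply: eqfun_same_integral (same_integral_lin 2^-1 2^-1 (measurable_funM mf (msin (t + th)))
    (measurable_funM mf (msin (t - th))) (bs _) (bs _) (sf _).2 (sf _).2) => x /=.
  by rewrite [(t + th) * x]mulrDl [(t - th) * x]mulrBl sinD sinB; field.
Qed.

Lemma same_trig_mul_sin (th : R) f : same_trig_integrals f ->
  same_trig_integrals (fun x => f x * sin (th * x)).
Proof.
move=> [mf [M fM] sf]; split.
- exact: measurable_funM.
- by exists M => x; apply: normrM_le1 => //; exact: normr_sin_le1.
- have bc t x : `|f x * cos (t * x)| <= M.
    by apply: normrM_le1 => //; exact: normr_cos_le1.
  have bs t x : `|f x * sin (t * x)| <= M.
    by apply: normrM_le1 => //; exact: normr_sin_le1.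
  move=> t; split.
    apply: eqfun_same_integral (same_integral_lin 2^-1 (- 2^-1) (measurable_funM mf (msin (t + th)))
      (measurable_funM mf (msin (t - th))) (bs _) (bs _) (sf _).2 (sf _).2) => x /=.
    by rewrite [(t + th) * x]mulrDl [(t - th) * x]mulrBl sinD sinB; field.
  apply: eqfun_same_integral (same_integral_lin 2^-1 (- 2^-1) (measurable_funM mf (mcos (t - th)))
    (measurable_funM mf (mcos (t + th))) (bc _) (bc _) (sf _).1 (sf _).1) => x /=.
  by rewrite [(t + th) * x]mulrDl [(t - th) * x]mulrBl cosB cosD; field.
Qed.

Hypothesis same_cos : forall t, \int[mu]_x cos (t * x) = \int[nu]_x cos (t * x).
Hypothesis same_sin : forall t, \int[mu]_x sin (t * x) = \int[nu]_x sin (t * x).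

Lemma same_trig_cst1 : same_trig_integrals (fun=> 1).
Proof.
split; first exact: measurable_cst.
  by exists 1 => _; rewrite normr1.
move=> t; rewrite /same_integral; split.
  under eq_Rintegral do rewrite mul1r.
  by under [RHS]eq_Rintegral do rewrite mul1r.
under eq_Rintegral do rewrite mul1r.
by under [RHS]eq_Rintegral do rewrite mul1r.
Qed.

Lemma same_trig_threshold (Z : R -> R) j :
  (forall f, same_trig_integrals f -> same_trig_integrals (fun x => f x * Z x)) ->
  same_trig_integrals (fun x => threshold j (Z x)).
Proof.
move=> hZ.
have hZn n f : same_trig_integrals f -> same_trig_integrals (fun x => f x * Z x ^+ n).
  elim: n f => [f hf|n IH f hf].
    by under eq_fun do rewrite expr0 mulr1.
  by under eq_fun do rewrite exprS mulrA; apply: IH; exact: hZ.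
have hq n f : same_trig_integrals f ->
    same_trig_integrals (fun x => f x * (1 - Z x ^+ (2 ^ j)) ^+ n).
  elim: n f => [f hf|n IH f hf].
    by under eq_fun do rewrite expr0 mulr1.
  under eq_fun do rewrite exprS mulrA.
  apply: IH; apply: eqfun_same_trig (same_trig_lin 1 (-1) hf
    (hZn (2 ^ j)%N f hf)) => x.
  ring.
have := hq (2 ^ (2 ^ j - j))%N _ same_trig_cst1.
by under eq_fun do rewrite mul1r.
Qed.

Lemma same_integral_cvg (f_ : nat -> R -> R) f :
  (forall n, measurable_fun setT (f_ n)) -> (forall n x, `|f_ n x| <= 1) ->
  (forall n, same_integral (f_ n)) ->
  (forall x, f_ n x @[n --> \oo] --> f x) ->
  measurable_fun setT f /\ same_integral f.
Proof.
move=> mf f1 sf ff.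
have mlim : measurable_fun setT f.
  by apply: (measurable_fun_cvg mf) => x _; exact: ff.
split=> //.
have lim (P : probability R R) :
    \int[P]_x f_ n x @[n --> \oo] --> \int[P]_x f x.
  have iF n := bounded_integrable P (mf n) (f1 n).
  have ffE x : (f_ n x)%:E @[n --> \oo] --> (f x)%:E.
    by apply: cvg_EFin; [exact: nearW|exact: ff].
  have [iL _ h] := @dominated_convergence _ _ _ P setT measurableT
    (fun n => EFin \o f_ n) (EFin \o f) (EFin \o cst 1)
    (fun n => proj2 (measurable_EFinP _ _) (mf n))
    (proj2 (measurable_EFinP _ _) mlim)
    (aeW _ (fun x _ => ffE x))
    (finite_measure_integrable_cst P 1 measurableT)
    (aeW _ (fun x n _ => f1 n x)).
  apply: fine_cvg; rewrite /Rintegral fineK; first exact: h.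
  exact: integrable_fin_num.
have E : (fun n => \int[mu]_x f_ n x) = (fun n => \int[nu]_x f_ n x).
  by apply/funext => n; exact: sf.
have := lim mu; rewrite E => h.
exact: (cvg_unique _ h (lim nu)).
Qed.

(* [Z] is an affine function of a cosine, chosen so that [0 <= Z <= 1] and
   [Z x <= 1/2] iff [y0 <= cos (th * (x - c))]. *)
Lemma same_integral_cos_superlevel (th c y0 : R) : -1 <= y0 <= 1 ->
  measurable_fun setT (\1_[set x | y0 <= cos (th * (x - c))] : R -> R) /\
  same_integral \1_[set x | y0 <= cos (th * (x - c))].
Proof.
move=> /andP[y0N1 y01].
pose Z x := 2^-1 + (y0 - cos (th * (x - c))) / 4.
have Z01 x : 0 <= Z x <= 1.
  by rewrite /Z; have := cos_le1 (th * (x - c)); have := cos_geN1 (th * (x - c)); lra.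
have hZ f : same_trig_integrals f -> same_trig_integrals (fun x => f x * Z x).
  move=> hf.
  have h1 := same_trig_lin (2^-1 + y0 / 4) (- cos (th * c) / 4) hf (same_trig_mul_cos th hf).
  apply: eqfun_same_trig (same_trig_lin 1 (- sin (th * c) / 4) h1 (same_trig_mul_sin th hf)).
  by move=> x; rewrite /Z mulrBr cosB; field.
apply: (@same_integral_cvg (fun j x => threshold j (Z x))).
- by move=> j; have [] := same_trig_threshold j hZ.
- by move=> j x; have /andP[h0 h1] := threshold01 j (Z01 x); rewrite ger0_norm.
- move=> j; have [_ _ /(_ 0)[+ _]] := same_trig_threshold j hZ.
  by apply: eqfun_same_integral => x; rewrite mul0r cos0 mulr1.
- move=> x; have := threshold_cvg (Z01 x).
  rewrite indicE (_ : (x \in _) = (Z x <= 2^-1))//.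
  by apply/idP/idP; rewrite inE /= /Z; lra.
Qed.

(** For small [th] the superlevel set of the cosine consists of the translates of [a, b] by
    multiples of 2 pi / th. As [th] tends to 0, all copies but one leave any given point behind:
    once th |x - c| and th r lie in [0, pi], where the cosine decreases, membership of x is decided
    by |x - c| <= r. *)
Lemma same_integral_itvcc (a b : R) : a <= b ->
  measurable_fun setT (\1_`[a, b] : R -> R) /\ same_integral \1_`[a, b].
Proof.
move=> ab; pose c := (a + b) / 2; pose r := (b - a) / 2.
pose th (n : nat) : R := n.+1%:R^-1.
have y01 n : -1 <= cos (th n * r) <= 1 by rewrite cos_geN1 cos_le1.
have key n := same_integral_cos_superlevel (th n) c (y01 n).
apply: (same_integral_cvg (fun n => (key n).1)).
- by move=> n x; rewrite indicE; case: (_ \in _); rewrite ?normr1 ?normr0.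
- by move=> n; have [] := key n.
move=> x; apply: cvg_near_cst.
have r0 : 0 <= r by rewrite divr_ge0// subr_ge0.
pose M := Num.max `|x - c| r.
have M0 : 0 <= M by rewrite le_max normr_ge0.
exists (Num.bound M) => // n /= Mn; rewrite !indicE; congr (_%:R : R); congr nat_of_bool.
have thM y : y <= M -> th n * y <= 1.
  move=> yM; rewrite mulrC ler_pdivrMr ?ltr0n// mul1r.
  apply: (le_trans yM); apply: (le_trans (ltW (archi_boundP M0))).
  by rewrite ler_nat (leq_trans Mn).
have th0 : 0 < th n by rewrite invr_gt0 ltr0n.
have pi1 : 1 <= pi :> R by rewrite (le_trans _ (pi_ge2 R))// ler1n.
have -> : (x \in `[a, b]%classic) = (`|x - c| <= r).
  by apply/idP/idP; rewrite inE /= in_itv /= ler_norml /c /r; lra.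
have cosE : cos (th n * (x - c)) = cos (th n * `|x - c|).
  by case: (ler0P (x - c)) => _; rewrite ?mulrN ?cosN.
have -> : (x \in [set y | cos (th n * r) <= cos (th n * (y - c))]) =
    (cos (th n * r) <= cos (th n * `|x - c|)).
  by apply/idP/idP; rewrite inE /= cosE.
have in0pi y : 0 <= y -> y <= M -> th n * y \in `[0, pi].
  move=> y0 yM; rewrite in_itv /= (le_trans (thM y yM) pi1) andbT.
  by rewrite mulr_ge0// ltW.
rewrite leNgt ltr_cos ?in0pi// ?le_max ?lexx ?orbT//.
by rewrite ltr_pM2l// -leNgt.
Qed.

Lemma same_integral_itvcy (a : R) : same_integral \1_`[a, +oo[.
Proof.
have key n : measurable_fun setT (\1_`[a, a + n%:R] : R -> R) /\
    same_integral \1_`[a, a + n%:R].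
  by apply: same_integral_itvcc; rewrite lerDl.
apply: (proj2 (same_integral_cvg (fun n => (key n).1) _ (fun n => (key n).2) _)).
  by move=> n x; rewrite indicE; case: (_ \in _); rewrite ?normr1 ?normr0.
move=> x; apply: cvg_near_cst.
exists (Num.bound `|x - a|) => // n /= xn; rewrite !indicE.
congr (_%:R : R); congr nat_of_bool.
have : x <= a + n%:R.
  rewrite -lerBlDl; apply: le_trans (ler_norm _) _.
  by apply: (le_trans (ltW (archi_boundP (normr_ge0 _)))); rewrite ler_nat.
by move=> h; apply/idP/idP; rewrite !inE /= !in_itv /= ?h ?andbT.
Qed.

Lemma characteristic_function_unique A : measurable A -> mu A = nu A.
Proof.
have ind (P : probability R R) (B : set R) : measurable B ->
    ((\int[P]_x \1_B x)%:E = P B)%E.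
  move=> mB; rewrite /Rintegral fineK; last first.
    rewrite integral_indic// setIT; exact: fin_num_measure.
  by rewrite integral_indic// setIT.
apply: (measure_unique (@RGenCInfty.G R) (fun n => `[- n%:R, +oo[%classic)).
- exact: RGenCInfty.measurableE.
- move=> _ _ [x ->] [y ->]; exists (Num.max x y).
  apply/seteqP; split=> z /=; rewrite !in_itv /= !andbT ge_max.
    by move=> [-> ->].
  by move=> /andP[-> ->].
- by move=> n; exists (- n%:R).
- rewrite -subTset => x _; exists (Num.bound `|x|) => //=.
  rewrite in_itv /= andbT lerNl; apply: le_trans (ler_norm _) _.
  by rewrite normrN ltW// archi_boundP.
- move=> _ [x ->]; have mI : measurable `[x, +oo[%classic by exact: measurable_itv.
  exact: (etrans (esym (ind mu _ mI))
    (etrans (congr1 EFin (same_integral_itvcy x)) (ind nu _ mI))).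
- by move=> n; rewrite ltey_eq fin_num_measure.
Qed.

End characteristic_function_uniqueness.

(** * The normal law *)

Section normal_characteristic_function.
Variable R : realType.
Notation leb := (@lebesgue_measure R).
Local Notation integ f := (leb.-integrable setT (EFin \o f)).
Implicit Types f g h : R -> R.

Lemma Rintegral_derivative_eq0 (G g : R -> R) :
  (forall x : R, is_derive x (1 : R) G (g x)) -> continuous g -> integ g ->
  G n%:R @[n --> \oo] --> (0 : R) -> G (- n%:R) @[n --> \oo] --> (0 : R) ->
  \int[leb]_x g x = 0.
Proof.
move=> dG cg ig G0 GN0.
have cG := is_derive_continuous dG.
(* [n.+1] keeps the interval nondegenerate, as [continuous_FTC2] requires. *)
pose I n := `[- n.+1%:R, n.+1%:R]%classic : set R.
have FTC n : (\int[leb]_x ((g \_ (I n)) x)%:E = (G n.+1%:R - G (- n.+1%:R))%:E)%E.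
  rewrite EFinB -(@continuous_FTC2 _ g G (- n.+1%:R) n.+1%:R).
  - by rewrite [RHS]integral_mkcond; apply: eq_integral => x _; rewrite restrict_EFin.
  - by rewrite gtrN// ltr0n.
  - exact: continuous_subspaceT.
  - split.
    + by move=> x _; have [] := dG x.
    + exact: cvg_at_right_filter (cG _).
    + exact: cvg_at_left_filter (cG _).
  - by move=> x _; rewrite derive1E; have [_ ->] := dG x.
have /measurable_EFinP mg := measurable_int _ ig.
have mI n : measurable (I n) by exact: measurable_itv.
have lim1 : (\int[leb]_x ((g \_ (I n)) x)%:E @[n --> \oo] --> \int[leb]_x (g x)%:E)%E.
  apply: (@dominated_cvg _ _ _ leb setT measurableT
    (fun n x => ((g \_ (I n)) x)%:E) (EFin \o g) (abse \o (EFin \o g))).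
  - move=> n; apply/measurable_EFinP.
    exact/(measurable_restrictT _ (mI n))/measurable_funTS.
  - move=> x _; apply: cvg_near_cst.
    exists (Num.bound `|x|) => // n /= xn; congr (_%:E).
    rewrite patchE ifT// inE /I /= in_itv /= -ler_norml.
    apply: le_trans (ltW (archi_boundP (normr_ge0 x))) _.
    by rewrite ler_nat (leq_trans xn).
  - by move=> x _.
  - exact: integrable_abse.
  - move=> n x _; rewrite /= lee_fin patchE; case: ifP => // _.
    by rewrite normr0.
have lim0 : (\int[leb]_x ((g \_ (I n)) x)%:E @[n --> \oo] --> 0%E)%E.
  under eq_fun do rewrite FTC.
  apply: cvg_EFin; first exact: nearW.
  rewrite -[X in _ --> X](subrr (0 : R)).
  by apply: cvgB; [rewrite (cvg_shiftS (fun n => G n%:R))|rewrite (cvg_shiftS (fun n => G (- n%:R)))].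
by rewrite /Rintegral (cvg_unique _ lim1 lim0).
Qed.

Variable s : R.
Hypothesis s0 : s != 0.
Let p x := normal_pdf 0 s x.

Let s2_gt0 : 0 < s ^+ 2. Proof. by rewrite exprn_even_gt0. Qed.

Lemma normal_pdf_gaussian (r : R) (x : R) : r != 0 ->
  normal_pdf 0 r x = normal_peak r * expR (- (r ^- 2) * x ^+ 2 / 2).
Proof.
move=> r0; rewrite normal_pdfE// /normal_fun subr0; congr (_ * expR _).
have : r ^+ 2 != 0 by rewrite expf_neq0.
by move=> rr; rewrite -mulr_natr; field.
Qed.

Let mp : measurable_fun setT p. Proof. exact: measurable_normal_pdf. Qed.
Let ip : integ p. Proof. exact: integrable_normal_pdf. Qed.

(* [1 + y <= exp y] at [y = x^2 / (4 s^2)] leaves a Gaussian density of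
   standard deviation [sqrt 2 * s] as the dominating function. *)
Lemma normr_mul_normal_pdf_le : exists2 C, 0 <= C &
  forall x, `|x| * p x <= C * normal_pdf 0 (Num.sqrt 2 * s) x.
Proof.
pose r := Num.sqrt 2 * s.
have r0 : r != 0 by rewrite mulf_neq0// gt_eqF// sqrtr_gt0.
have r2 : r ^+ 2 = 2 * s ^+ 2 by rewrite /r exprMn sqr_sqrtr.
have pk0 := normal_peak_gt0 r0.
exists (normal_peak s * (1 + 4 * s ^+ 2) / normal_peak r).
  by rewrite divr_ge0 ?ltW// mulr_gt0 ?normal_peak_gt0// addr_gt0// mulr_gt0.
move=> x; rewrite /p !normal_pdf_gaussian// -/r.
pose E := expR (x ^+ 2 / (4 * s ^+ 2)); pose F := expR (- (r ^- 2) * x ^+ 2 / 2).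
have -> : expR (- s ^- 2 * x ^+ 2 / 2) = E^-1 * F.
  rewrite -expRN -expRD r2; congr expR.
  by move: (s ^+ 2) s2_gt0 => a a0; field; rewrite gt_eqF.
have E1 : 1 + x ^+ 2 / (4 * s ^+ 2) <= E by exact: expR_ge1Dx.
have E0 : 0 < E by exact: expR_gt0.
have F0 : 0 < F by exact: expR_gt0.
have key : `|x| <= (1 + 4 * s ^+ 2) * E.
  have x1 : `|x| <= 1 + x ^+ 2.
    rewrite -real_normK ?num_real//; have := sqr_ge0 (`|x| - 1).
    by move: `|x| (normr_ge0 x) => y y0; nra.
  apply: le_trans x1 _; apply: le_trans (ler_wpM2l _ E1); last first.
    by rewrite addr_ge0// mulr_ge0// ltW.
  move: (s ^+ 2) s2_gt0 (x ^+ 2) (sqr_ge0 x) => a a0 y y0.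
  have -> : (1 + 4 * a) * (1 + y / (4 * a)) = 1 + y + 4 * a + y / (4 * a).
    by field; rewrite gt_eqF.
  by rewrite -addrA lerDl addr_ge0// ?divr_ge0// ?mulr_ge0 ?ltW.
have -> : normal_peak s * (1 + 4 * s ^+ 2) / normal_peak r * (normal_peak r * F) =
    normal_peak s * ((1 + 4 * s ^+ 2) * F).
  by field; rewrite gt_eqF.
rewrite mulrCA ler_wpM2l ?normal_peak_ge0// mulrA.
by apply: ler_wpM2r; [exact: ltW|rewrite ler_pdivrMr].
Qed.

Let ixp : integ (p \* @idfun R).
Proof.
have [C C0 HC] := normr_mul_normal_pdf_le.
have iq : integ (fun x => C * normal_pdf 0 (Num.sqrt 2 * s) x).
  by apply: eq_integrable (integrableZl measurableT C
    (integrable_normal_pdf 0 (Num.sqrt 2 * s))).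
apply: integrable_le_normr iq _; first exact: (measurable_funM mp (@measurable_id _ _ _)).
move=> x; rewrite normrM mulrC [`|p x|]ger0_norm ?normal_pdf_ge0//.
by rewrite [leRHS]ger0_norm// mulr_ge0// normal_pdf_ge0.
Qed.

(** Since |x| p(x) is bounded, the density is O(1/n) along the sequence; [n] and [- n] are the
    instances needed for boundary terms. *)
Lemma normal_pdf_cvg0 (u : nat -> R) : (forall n, `|u n| = n%:R) ->
  p (u n) @[n --> \oo] --> (0 : R).
Proof.
move=> un; have [C C0 HC] := normr_mul_normal_pdf_le.
pose r := Num.sqrt 2 * s.
have r0 : r != 0 by rewrite mulf_neq0// gt_eqF// sqrtr_gt0.
rewrite -cvg_shiftS /=.
apply: (@squeeze_cvgr _ _ _ _ (fun=> 0) (fun n => C * normal_peak r * harmonic n)).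
- apply: nearW => n; rewrite normal_pdf_ge0 /= /harmonic ler_pdivlMr ?ltr0n//.
  rewrite mulrC -un; apply: le_trans (HC _) _; rewrite ler_wpM2l//.
  exact: normal_pdf_ub.
- exact: cvg_cst.
- rewrite -(mulr0 (C * normal_peak r)); apply: cvgM; first exact: cvg_cst.
  exact: cvg_harmonic.
Qed.

Let dp (x : R) : is_derive x (1 : R) p (- (s ^- 2) * x * p x).
Proof.
have -> : p = cst (normal_peak s) * (fun x => expR (- (s ^- 2) * x ^+ 2 / 2)).
  by apply/funext => y; rewrite /p normal_pdf_gaussian.
apply: (is_derive1_eq (is_derive1M (is_derive_cst _ _ _)
   (is_derive_gaussian (s ^- 2) x))).
by rewrite /= !fctE /=; ring.
Qed.

(** Stein's identity: the integral of (p h)' = p h' - s^-2 x p h over the line is zero. *)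
Lemma normal_stein (h h' : R -> R) (M : R) : (forall x : R, is_derive x (1 : R) h (h' x)) ->
  continuous h' -> (forall x, `|h x| <= 1) -> (forall x, `|h' x| <= M) ->
  \int[leb]_x (p x * x * h x) = s ^+ 2 * \int[leb]_x (p x * h' x).
Proof.
move=> dh ch' h1 h'M.
have ch := is_derive_continuous dh.
have mh : measurable_fun setT h by exact: continuous_measurable_fun.
have mh' : measurable_fun setT h' by exact: continuous_measurable_fun.
have i1 : integ (p \* h').
  have := integrableMl measurableT ip mh' _; apply.
  exists M; split; first exact: num_real.
  by move=> x Mx y _; apply: le_trans (h'M y) _; exact: ltW.
have i2 : integ (fun x => p x * x * h x).
  exact: (integrable_mulr_le1 ixp mh h1).
have i2' := integrableZl measurableT (- s ^- 2) i2.
have dG (x : R) : is_derive x (1 : R) (p * h) (p x * h' x + - s ^- 2 * (p x * x * h x)).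
  apply: (is_derive1_eq (is_derive1M (dp x) (dh x))); ring.
have cp : continuous p := is_derive_continuous dp.
have lim u : (forall n, `|u n| = n%:R) -> (p * h) (u n) @[n --> \oo] --> (0 : R).
  move=> un; apply/norm_cvg0P.
  have h2 : `|p (u n)| @[n --> \oo] --> (0 : R).
    by apply/norm_cvg0P; exact: normal_pdf_cvg0.
  apply: (@squeeze_cvgr _ _ _ _ (fun=> 0) (fun n => `|p (u n)|)) => //; last exact: cvg_cst.
  by apply: nearW => n; rewrite normr_ge0 /= !fctE normrM ler_piMr.
have := @Rintegral_derivative_eq0 (p * h) _ dG _ _ _ _.
rewrite RintegralD// RintegralZl// => H.
have {}H : \int[leb]_x (p x * h' x) + - s ^- 2 * \int[leb]_x (p x * x * h x) = 0.
  apply: H.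
  - move=> x; apply: cvgD; first by apply: cvgM; [exact: cp|exact: ch'].
    apply: cvgM; first exact: cvg_cst.
    by apply: cvgM; [apply: cvgM; [exact: cp|exact: cvg_id]|exact: ch].
  - have := integrableD measurableT i1 i2'.
    by apply: eq_integrable.
  - by apply: lim => n; rewrite normr_nat.
  - by apply: lim => n; rewrite normrN normr_nat.
move/eqP: H; rewrite mulNr subr_eq0 => /eqP ->.
by rewrite mulrA mulfV ?mul1r// expf_neq0.
Qed.

(** Stein's identity for [cos (u * x)] and [sin (u * x)] yields the hypotheses of [gaussian_ode], so
    the equation that forces Gaussianity also computes the Gaussian characteristic function. *)
Lemma normal_density_trig t : 0 <= t ->
  \int[leb]_x (p x * cos (t * x)) = expR (- (s ^+ 2) * t ^+ 2 / 2) /\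
  \int[leb]_x (p x * sin (t * x)) = 0.
Proof.
move=> t0; have mid : measurable_fun [set: measurableTypeR R] (@idfun R).
  exact: measurable_id.
have dl (u x : R) : is_derive x (1 : R) (fun x => u * x) u.
  apply: (is_derive1_eq (is_derive1M (is_derive_cst _ _ _) (is_derive_id _ _))).
  by rewrite mulr1 mulr0 addr0.
have dcos (u x : R) : is_derive x (1 : R) (fun x => cos (u * x)) (- u * sin (u * x)).
  apply: (is_derive1_eq (is_derive1_comp (is_derive_cos (u * x)) (dl u x))); ring.
have dsin (u x : R) : is_derive x (1 : R) (fun x => sin (u * x)) (u * cos (u * x)).
  apply: (is_derive1_eq (is_derive1_comp (is_derive_sin (u * x)) (dl u x))); ring.
have ccos (u : R) := is_derive_continuous (dcos u).
have csin (u : R) := is_derive_continuous (dsin u).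
apply: (@gaussian_ode R (fun u => \int[leb]_x (p x * cos (u * x)))
  (fun u => \int[leb]_x (p x * sin (u * x)))
  (fun u => \int[leb]_x (p x * x * cos (u * x)))
  (fun u => \int[leb]_x (p x * x * sin (u * x))) (s ^+ 2) t t0).
- by move=> u; exact: (is_derive_cos_moment u mid ip ixp).
- by move=> u; exact: (is_derive_sin_moment u mid ip ixp).
- move=> u _; rewrite (@normal_stein _ (fun x => - u * sin (u * x)) `|u| (dcos u)).
  + rewrite -[in RHS]mulrA [in RHS]mulNr -mulrN; congr (_ * _); rewrite -mulNr -RintegralZl//.
      by apply: eq_Rintegral => x _; ring.
    apply: (integrable_mulr_le1 ip); first exact: (measurable_sin_scale u mid).
    by move=> x; exact: normr_sin_le1.
  + by move=> x; apply: cvgM; [exact: cvg_cst|exact: csin].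
  + by move=> x; exact: normr_cos_le1.
  + by move=> x; rewrite normrM normrN ler_piMr// normr_sin_le1.
- move=> u _; rewrite (@normal_stein _ (fun x => u * cos (u * x)) `|u| (dsin u)).
  + rewrite -[in RHS]mulrA; congr (_ * _); rewrite -RintegralZl//.
      by apply: eq_Rintegral => x _; ring.
    apply: (integrable_mulr_le1 ip); first exact: (measurable_cos_scale u mid).
    by move=> x; exact: normr_cos_le1.
  + by move=> x; apply: cvgM; [exact: cvg_cst|exact: ccos].
  + by move=> x; exact: normr_sin_le1.
  + by move=> x; rewrite normrM ler_piMr// normr_cos_le1.
- under eq_Rintegral do rewrite mul0r cos0 mulr1.
  by rewrite /Rintegral integral_normal_pdf.
- under eq_Rintegral do rewrite mul0r sin0 mulr0.
  by rewrite Rintegral_cst// mul0r.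
Qed.

End normal_characteristic_function.

Section gaussian_law.
Variable R : realType.
Notation leb := (@lebesgue_measure R).

Lemma integral_normal_prob (m s : R) (f : R -> \bar R) :
  measurable_fun setT f ->
  (\int[normal_prob m s]_x `|f x| < +oo)%E ->
  (\int[normal_prob m s]_x f x = \int[leb]_x (f x * (normal_pdf m s x)%:E))%E.
Proof.
move=> mf finf.
rewrite -(Radon_Nikodym_change_of_variables (normal_prob_dominates m s))//=; last first.
  by apply/integrableP; split.
apply: ae_eq_integral => //.
- apply: emeasurable_funM => //; apply: (measurable_int leb).
  by apply: Radon_Nikodym_integrable; exact: normal_prob_dominates.
- apply: emeasurable_funM => //=; apply/measurableT_comp => //=.
  exact: measurable_normal_pdf.
- apply: ae_eqe_mul2l => /=.
  rewrite Radon_NikodymE//=; first exact: normal_prob_dominates.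
  move=> abmu; case: cid => /= h [h1 h2 h3].
  apply: integral_ae_eq => //=.
  + by apply/measurableT_comp =>//; exact: measurable_normal_pdf.
  + by move=> E E01 mE; rewrite -h3.
Qed.

Context d (T : measurableType d) (P : probability T R) (X : {RV P >-> R}).
Variable v : R.
Hypothesis v0 : 0 < v.
Hypothesis chf : forall t, 0 <= t ->
  \int[P]_s cos (t * X s) = expR (- v * t ^+ 2 / 2) /\
  \int[P]_s sin (t * X s) = 0.

Lemma gaussian_of_characteristic_function : gaussian X.
Proof.
pose s := Num.sqrt v.
have s0 : s != 0 by rewrite gt_eqF// sqrtr_gt0.
have s2 : s ^+ 2 = v by rewrite sqr_sqrtr// ltW.
exists 0, s; split=> // A mA.
have mid : measurable_fun [set: R] (@idfun R) by exact: measurable_id.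
have mI : @measurable_fun _ _ (measurableTypeR R) R setT (@idfun R).
  exact: measurable_id.
(* Pushing [normal_prob] forward along the identity gives it the same type as [distribution P X]. *)
pose I : {mfun measurableTypeR R >-> R} :=
  @mfun_Sub _ _ (measurableTypeR R) R _ (mem_set mI).
pose N : probability R R := distribution (normal_prob 0 s) I.
have push (f : R -> R) : measurable_fun setT f -> (forall x, `|f x| <= 1) ->
    \int[distribution P X]_x f x = \int[P]_t f (X t).
  move=> mf f1; rewrite /Rintegral /distribution integral_pushforward//.
  - exact/measurable_EFinP.
  - apply: (@integrable_le_normr _ _ _ _ (f \o X) (cst 1)).
    + exact: (measurableT_comp mf (measurable_funP X)).
    + exact: finite_measure_integrable_cst.
    + by move=> t; rewrite /= normr1.
have dens (f : R -> R) : measurable_fun setT f -> (forall x, `|f x| <= 1) ->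
    \int[N]_x f x = \int[leb]_x (normal_pdf 0 s x * f x).
  move=> mf f1.
  have mf' : measurable_fun [set: measurableTypeR R] f.
    exact: (measurableT_comp mf mI).
  have iF : (normal_prob 0 s).-integrable setT (EFin \o f).
    apply: (@integrable_le_normr _ (measurableTypeR R) R (normal_prob 0 s) f (cst 1)) => //.
    + exact: finite_measure_integrable_cst.
    + by move=> t; rewrite /= normr1.
  rewrite /Rintegral /N /distribution integral_pushforward//; last first.
    exact/measurable_EFinP.
  rewrite preimage_setT integral_normal_prob.
  - by congr fine; apply: eq_integral => x _; rewrite /= -EFinM mulrC.
  - exact/measurable_EFinP.
  - by have /integrableP[] := iF.
have mc t : measurable_fun [set: R] (fun x => cos (t * x)).
  exact: (measurable_cos_scale t mid).
have ms t : measurable_fun [set: R] (fun x => sin (t * x)).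
  exact: (measurable_sin_scale t mid).
have bc t (x : R) : `|cos (t * x)| <= 1 by exact: normr_cos_le1.
have bs t (x : R) : `|sin (t * x)| <= 1 by exact: normr_sin_le1.
have pos t : 0 <= t ->
    \int[distribution P X]_x cos (t * x) = \int[N]_x cos (t * x) /\
    \int[distribution P X]_x sin (t * x) = \int[N]_x sin (t * x).
  move=> t0; rewrite !push// !dens//.
  have [-> ->] := chf t0; have [-> ->] := normal_density_trig s0 t0.
  by rewrite s2.
apply: (@characteristic_function_unique R (distribution P X) N) => //.
(* Negative arguments follow by parity. *)
- move=> t; have [/pos[]//|t0] := leP 0 t.
  have nt0 : 0 <= - t by rewrite oppr_ge0 ltW.
  have [+ _] := pos (- t) nt0.
  under eq_Rintegral do rewrite mulNr cosN.
  by under [X in _ = X]eq_Rintegral do rewrite mulNr cosN.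
- move=> t; have [/pos[]//|t0] := leP 0 t.
  have nt0 : 0 <= - t by rewrite oppr_ge0 ltW.
  have [_] := pos (- t) nt0.
  have opp (Q : probability R R) : \int[Q]_x sin (- t * x) = - \int[Q]_x sin (t * x).
    rewrite -[RHS]mulN1r -RintegralZl//; last exact: bounded_integrable (ms t) (bs t).
    by apply: eq_Rintegral => x _; rewrite mulNr sinN mulN1r.
  by rewrite !opp => /oppr_inj.
Qed.

End gaussian_law.

(** * LiNGAM models *)

Section centered_square_integrable.
Context d (T : measurableType d) (R : realType) (P : probability T R).
Local Notation integ f := (P.-integrable setT (EFin \o f)).
Implicit Types f g : T -> R.

Definition centered f : Prop :=
  [/\ integ f, integ (f \* f) & \int[P]_t f t = 0].

Lemma centered0 : centered (fun=> 0).
Proof.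
have i0 : integ (fun=> 0 : R) by exact: finite_measure_integrable_cst.
split=> //; last exact: Rintegral_probability_cst.
by apply: eqfun_integrable i0 => t /=; rewrite mulr0.
Qed.

Lemma centeredZ (a : R) f : centered f -> centered (fun t => a * f t).
Proof.
move=> [iF iFF f0]; split; first exact: integrable_scaler.
  apply: eqfun_integrable (integrable_scaler (a * a) iFF) => t /=; ring.
by rewrite RintegralZl// f0 mulr0.
Qed.

Lemma centeredD f g : centered f -> centered g -> centered (fun t => f t + g t).
Proof.
move=> [iF iFF f0] [iG iGG g0]; split; first exact: integrable_addr.
  have mf := integrable_measurable iF; have mg := integrable_measurable iG.
  apply: (integrable_le_normr _ (integrable_lin3 2 2 0 iFF iGG iGG)).
    by apply: measurable_funM; exact: measurable_funD.
  move=> t /=; rewrite mul0r addr0 -!expr2 !ger0_norm ?sqr_ge0//.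
    rewrite -subr_ge0 [leRHS](_ : _ = (f t - g t) ^+ 2) ?sqr_ge0//.
    ring.
  by rewrite addr_ge0// mulr_ge0// sqr_ge0.
by rewrite RintegralD// f0 g0 addr0.
Qed.

Lemma centered_sum n (Q : pred 'I_n) (f : 'I_n -> T -> R) :
  (forall i, centered (f i)) -> centered (fun t => \sum_(i | Q i) f i t).
Proof.
move=> cf; elim: (index_enum _) => [|i r IH].
  by under eq_fun do rewrite big_nil; exact: centered0.
under eq_fun do rewrite big_cons.
by case: (Q i) => //; exact: centeredD.
Qed.

Lemma indep_centeredM f g : centered f -> centered g -> indep P f g ->
  integ (f \* g) /\ \int[P]_t (f t * g t) = 0.
Proof.
move=> [iF _ f0] [iG _ g0] fg.
by have [ifg ->] := indep_expectationM iF iG fg; rewrite f0 mul0r.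
Qed.

Lemma covE (X Y : T -> R) : centered X -> centered Y ->
  cov P X Y = \int[P]_t (X t * Y t).
Proof.
move=> [_ _ X0] [_ _ Y0]; rewrite /cov unlock.
have EE f : fine ('E_P[f])%E = \int[P]_t f t by rewrite unlock.
rewrite !EE X0 Y0; apply: eq_Rintegral => t _.
by rewrite !fctE /= !subr0.
Qed.

Lemma varE (X : T -> R) : centered X -> var P X = \int[P]_t (X t * X t).
Proof. by move=> cX; rewrite -covE. Qed.

Lemma centered_RV (X : {RV P >-> R}) : (X : T -> R) \in Lfun P 2%:E ->
  ('E_P[X] = 0)%E -> centered X.
Proof.
move=> X2 X0.
have X1 : (X : T -> R) \in Lfun P 1.
  by apply: (Lfun_subset12 (fin_num_measure P _ measurableT)).
split; first exact/Lfun1_integrable.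
  apply/Lfun1_integrable; exact: Lfun2_mul_Lfun1.
by rewrite -[LHS]/(fine (\int[P]_t (X t)%:E)%E) -expectation_def X0.
Qed.

Lemma var_gt0 (X : {RV P >-> R}) : (X : T -> R) \in Lfun P 2%:E ->
  ('V_P[X] != 0)%E -> 0 < var P X.
Proof.
move=> X2 V0; rewrite lt_neqAle; apply/andP; split.
  apply: contra V0 => /eqP h; rewrite -(fineK (variance_fin_num X2)).
  by rewrite -/(var P X) -h.
by rewrite fine_ge0// variance_ge0.
Qed.

End centered_square_integrable.

(** * Acyclic matrices and their mixing matrices *)

Section acyclic_matrices.
Variable R : comUnitRingType.

(** Any distinct natural numbers may serve as ranks, so a ranking survives the deletion of a
    variable without renumbering. *)
Definition causal_rank n (B : 'M[R]_n) (k : 'I_n -> nat) : Prop :=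
  injective k /\ forall i j, (k i <= k j)%N -> B i j = 0.

Lemma acyclic_causal_rank n (B : 'M[R]_n) :
  permutable_to_strictly_lower_triangular B -> exists k, causal_rank B k.
Proof.
move=> [s Bs]; exists (fun i => nat_of_ord ((s^-1)%g i)); split.
  by move=> i j /val_inj /perm_inj.
by move=> i j ij; have := Bs _ _ ij; rewrite !mxE !permKV.
Qed.

(** Counting the smaller ranks compresses the ranks to 0, ..., n - 1, which gives a permutation. *)
Lemma causal_rank_acyclic n (B : 'M[R]_n) k :
  causal_rank B k -> permutable_to_strictly_lower_triangular B.
Proof.
move=> [k_inj Bk].
pose rk i := #|[set l | (k l < k i)%N]%SET|.
have rk_lt i : (rk i < n)%N.
  have : ([set l | (k l < k i)%N]%SET \proper [set: 'I_n]%SET).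
    apply/properP; split; first exact: finset.subsetT.
    by exists i; rewrite !inE ?ltnn.
  by move=> /proper_card; rewrite cardsT card_ord.
have rk_mono i j : (k i < k j)%N -> (rk i < rk j)%N.
  move=> ij; apply: proper_card; apply/properP; split.
    by apply/fintype.subsetP => l; rewrite !inE => /ltn_trans; exact.
  by exists i; rewrite !inE ?ltnn.
have rk_inj : injective (fun i => Ordinal (rk_lt i)).
  move=> i j /(congr1 val) /= rkij; apply: k_inj.
  by have [/rk_mono|/rk_mono|//] := ltngtP (k i) (k j); rewrite rkij ltnn.
exists (perm rk_inj)^-1%g => i j ij; rewrite !mxE; apply: Bk.
rewrite leqNgt; apply/negP => /rk_mono.
have rkK m : rk ((perm rk_inj)^-1%g m) = m.
  by have /(congr1 val) := permKV (perm rk_inj) m; rewrite permE.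
by rewrite !rkK ltnNge ij.
Qed.

Lemma acyclic_unitmx n (B : 'M[R]_n) :
  permutable_to_strictly_lower_triangular B -> (1%:M - B) \in unitmx.
Proof.
move=> [s Bs]; rewrite unitmxE.
have : \det (row_perm s (col_perm s (1%:M - B))) = 1.
  rewrite det_trig; last first.
    apply/is_trig_mxP => i j ij; have := Bs _ _ (ltnW ij); rewrite !mxE => ->.
    by rewrite subr0 (inj_eq perm_inj) -val_eqE (ltn_eqF ij).
  rewrite big1// => i _; have := Bs _ _ (leqnn i); rewrite !mxE => ->.
  by rewrite eqxx subr0.
rewrite row_permE col_permE !det_mulmx mulrA => h.
by move: (unitr1 R); rewrite -[X in X \is a _ -> _]h !unitrM => /andP[/andP[_ ->]].
Qed.

Definition mixing n (B : 'M[R]_n) : 'M[R]_n := invmx (1%:M - B).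

Section mixing.
Variables (n : nat) (B : 'M[R]_n).
Hypothesis B_acyclic : permutable_to_strictly_lower_triangular B.
Let A := mixing B.

Lemma mixingEl : A = 1%:M + B *m A.
Proof.
apply/eqP; rewrite -subr_eq; apply/eqP.
by have := mulmxV (acyclic_unitmx B_acyclic); rewrite mulmxBl mul1mx.
Qed.

Lemma mixingEr : A = 1%:M + A *m B.
Proof.
apply/eqP; rewrite -subr_eq; apply/eqP.
by have := mulVmx (acyclic_unitmx B_acyclic); rewrite mulmxBr mulmx1.
Qed.

Lemma mixing_lower k i l : causal_rank B k -> (k i < k l)%N -> A i l = 0.
Proof.
move=> [k_inj Bk].
have [m] := ubnP (k i); elim: m i => // m IH i im il.
rewrite mixingEl !mxE big1 ?addr0.
  by case: eqP => // eil; move: il; rewrite eil ltnn.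
move=> h _; have [hi|ih] := ltnP (k h) (k i); last by rewrite Bk// mul0r.
rewrite IH ?mulr0//; first exact: leq_trans hi _.
exact: ltn_trans il.
Qed.

Lemma mixing_diag i : A i i = 1.
Proof.
have [k kB] := acyclic_causal_rank B_acyclic.
rewrite mixingEl !mxE eqxx big1 ?addr0// => h _.
have [hi|ih] := ltnP (k h) (k i); last by rewrite kB.2// mul0r.
by rewrite (mixing_lower kB hi) mulr0.
Qed.

Lemma mixing_exogenous j : exogenous B j -> forall l, A j l = (j == l)%:R.
Proof.
have [k kB] := acyclic_causal_rank B_acyclic.
move=> Bj l; rewrite mixingEl !mxE big1 ?addr0// => h _.
have [->|hj] := eqVneq h j; first by rewrite kB.2 ?mul0r.
by rewrite Bj// mul0r.
Qed.

(** Effects along several paths may cancel in single entries of row j of A, but not in all: if the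
    row were a unit row, A = 1 + A B would read A_jh = B_jh off the diagonal. *)
Lemma mixing_nonexogenous j : ~ exogenous B j -> exists2 l, l != j & A j l != 0.
Proof.
move=> Bj; apply: contrapT => Aj; apply: Bj => h hj.
have A0 l : l != j -> A j l = 0.
  by move=> lj; apply/eqP/negPn/negP => Ajl; apply: Aj; exists l.
have := A0 h hj; rewrite mixingEr !mxE eq_sym (negbTE hj) add0r.
rewrite (bigD1 j)//= mixing_diag mul1r big1 ?addr0// => l lj.
by rewrite A0// mul0r.
Qed.

Lemma exists_exogenous (i0 : 'I_n) : exists j, exogenous B j.
Proof.
have [k kB] := acyclic_causal_rank B_acyclic.
case: (@arg_minnP _ i0 xpredT k isT) => j _ kj; exists j => h _.
by apply: kB.2; exact: kj.
Qed.

End mixing.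
End acyclic_matrices.

(** * The independence criterion within one model *)

Section lingam_theory.
Context d (T : measurableType d) (R : realType) (P : probability T R).
Local Notation integ f := (P.-integrable setT (EFin \o f)).

Section fixed_model.
Variables (n : nat) (x : 'I_n -> {RV P >-> R}) (B : 'M[R]_n)
  (e : 'I_n -> {RV P >-> R}).
Hypothesis L : lingam x B e.
Let A := mixing B.
Let acyclic := lingam_acyclic L.

Lemma lingam_mixing i t : x i t = \sum_l A i l * e l t.
Proof.
pose X : 'cV[R]_n := \col_i x i t; pose E : 'cV[R]_n := \col_i e i t.
have XE : (1%:M - B) *m X = E.
  apply/colP => a; rewrite mulmxBl mul1mx !mxE.
  under eq_bigr do rewrite mxE.
  by rewrite (lingam_model L a t) addrC addKr.
have : X = A *m E by rewrite -XE mulKmx// acyclic_unitmx.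
move=> /colP /(_ i); rewrite !mxE => ->.
by apply: eq_bigr => l _; rewrite mxE.
Qed.

Lemma lingam_centered_noise l : centered P (e l).
Proof.
apply: centered_RV; first exact: (lingam_square_integrable L l).
exact: (lingam_mean0 L l).
Qed.

Definition noise_comb (J : {set 'I_n}) (a : 'I_n -> R) (t : T) : R :=
  \sum_(l in J) a l * e l t.

Lemma noise_comb_centered J a : centered P (noise_comb J a).
Proof.
apply: (centered_sum (mem J) (f := fun l t => a l * e l t)) => l.
exact/centeredZ/lingam_centered_noise.
Qed.

Lemma noise_comb_indep (J K : {set 'I_n}) a b : [disjoint J & K]%B ->
  indep P (noise_comb J a) (noise_comb K b).
Proof.
move=> JK; apply: (generated_by_indep (lingam_independent L) JK);
  exact: generated_by_lincomb.
Qed.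

Lemma noise_comb1 j a t : noise_comb [set j]%SET a t = a j * e j t.
Proof. by rewrite /noise_comb big_set1. Qed.

Lemma noise_var_gt0 j : 0 < \int[P]_t (e j t * e j t).
Proof.
rewrite -varE; last exact: lingam_centered_noise.
exact: var_gt0 (lingam_square_integrable L j) (lingam_var_neq0 L j).
Qed.

Lemma lingam_centered i : centered P (x i).
Proof.
have -> : (x i : T -> R) = noise_comb [set: 'I_n]%SET (A i).
  apply/funext => t; rewrite lingam_mixing /noise_comb.
  by apply: eq_bigl => l; rewrite finset.in_setT.
exact: noise_comb_centered.
Qed.

Let rest j i : T -> R := noise_comb [set~ j]%SET (A i).

Let lingam_split j i t : x i t = A i j * e j t + rest j i t.
Proof.
rewrite lingam_mixing (bigD1 j)//=; congr (_ + _).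
by apply: eq_bigl => l; rewrite !inE.
Qed.

Let noise_rest_indep j i : indep P (e j) (rest j i).
Proof.
have -> : (e j : T -> R) = noise_comb [set j]%SET (fun=> 1).
  by apply/funext => t; rewrite noise_comb1 mul1r.
apply: noise_comb_indep; rewrite -setI_eq0; apply/eqP/setP => l.
by rewrite !inE; case: eqP.
Qed.

Lemma exogenousE j t : exogenous B j -> x j t = e j t.
Proof.
move=> Bj; rewrite lingam_mixing (bigD1 j)//= big1 ?addr0.
  by rewrite mixing_exogenous// eqxx mul1r.
by move=> l lj; rewrite mixing_exogenous// eq_sym (negbTE lj) mul0r.
Qed.

(** The rest of x_i is uncorrelated with e_j = x_j, so the regression coefficient is the total
    effect A_ij. *)
Lemma exogenous_residual j i t : exogenous B j ->
  residual x j i t = x i t - A i j * e j t.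
Proof.
move=> Bj.
have xj : (x j : T -> R) = e j by apply/funext => s; exact: exogenousE.
have cj := lingam_centered_noise j.
have [iF iFF F0] := cj.
have [iR _ _] := noise_comb_centered [set~ j]%SET (A i).
have [ire re] := indep_centeredM (noise_comb_centered _ _) cj
  (indep_sym (@noise_rest_indep j i)).
have covij : cov P (x i) (x j) = A i j * \int[P]_s (e j s * e j s).
  rewrite covE; [|exact: lingam_centered..].
  transitivity (A i j * \int[P]_s (e j s * e j s) +
                \int[P]_s (rest j i s * e j s)); last by rewrite re addr0.
  rewrite -RintegralZl// -RintegralD//; last exact: integrable_scaler.
  by apply: eq_Rintegral => s _; rewrite xj (lingam_split j); ring.
have varj : var P (x j) = \int[P]_s (e j s * e j s).
  by rewrite varE ?xj//; exact: lingam_centered_noise.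
rewrite /residual covij varj mulfK ?gt_eqF ?noise_var_gt0//.
by rewrite -(exogenousE t Bj).
Qed.

Lemma exogenous_independent_of_residuals j :
  exogenous B j -> independent_of_residuals x j.
Proof.
move=> Bj i _; have := @noise_rest_indep j i.
have -> : (e j : T -> R) = x j by apply/funext => t; rewrite exogenousE.
have -> : rest j i = residual x j i; last by [].
by apply/funext => t; rewrite exogenous_residual// (lingam_split j) addrC addKr.
Qed.

Lemma independent_of_residuals_exogenous j :
  independent_of_residuals x j -> exogenous B j.
Proof.
move=> xj_indep; apply: contrapT => Bj.
have [k0 kB] := acyclic_causal_rank acyclic.
have [l0 l0j Al0] := mixing_nonexogenous acyclic Bj.
(* the causally first noise term, other than e_j, that enters x_j *)
have [k [kj Ajk kmin]] : exists k, [/\ k != j, A j k != 0 &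
    forall l, l != j -> A j l != 0 -> (k0 k <= k0 l)%N].
  have l0P : (l0 != j) && (A j l0 != 0) by rewrite l0j.
  case: (@arg_minnP _ l0 (fun l => (l != j) && (A j l != 0)) k0 l0P) => k.
  move=> /andP[kj Ajk] kmin; exists k; split=> // l lj Al.
  by apply: kmin; rewrite lj.
set a := A j k in Ajk.
have kltj : (k0 k < k0 j)%N.
  rewrite ltnNge leq_eqVlt negb_or; apply/andP; split.
    by apply: contra kj => /eqP /kB.1 ->.
  by apply/negP => /(mixing_lower acyclic kB) h; rewrite /a h eqxx in Ajk.
(* Noise before and after e_k: minimality of [k] keeps [K1] out of x_j, and triangularity of A keeps
   [K2] out of x_k. *)
pose K1 := [set l | (k0 l < k0 k)%N]%SET.
pose K2 := [set l | (k0 k < k0 l)%N]%SET.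
pose W := noise_comb K2 (fun l => A j l / a).
have split3 (F : 'I_n -> R) : \sum_l F l = \sum_(l in K1) F l + F k + \sum_(l in K2) F l.
  rewrite (bigID (fun l => l \in K1))/= -addrA; congr (_ + _).
  rewrite (bigD1 k)/=; last by rewrite inE ltnn.
  congr (_ + _); apply: eq_bigl => l; rewrite !inE -leqNgt ltn_neqAle andbC.
  by congr (_ && _); rewrite eq_sym (inj_eq kB.1).
have xjE t : x j t = a * (e k t + W t).
  rewrite lingam_mixing split3 big1 ?add0r; last first.
    move=> l; rewrite inE => lk.
    have [lj|lj] := eqVneq l j; first by move: (ltn_trans lk kltj); rewrite lj ltnn.
    have [->|Al] := eqVneq (A j l) 0; first by rewrite mul0r.
    by move: (kmin l lj Al); rewrite leqNgt lk.
  rewrite mulrDr -/a; congr (_ + _); rewrite /W /noise_comb mulr_sumr.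
  by apply: eq_bigr => l _; field.
have xkE t : x k t = e k t + noise_comb K1 (A k) t.
  rewrite lingam_mixing split3 mixing_diag// mul1r [X in _ + X]big1 ?addr0.
    by rewrite addrC.
  by move=> l; rewrite inE => /(mixing_lower acyclic kB) ->; rewrite mul0r.
have cX := lingam_centered_noise k.
have cW : centered P W by exact: noise_comb_centered.
have eE l : (e l : T -> R) = noise_comb [set l]%SET (fun=> 1).
  by apply/funext => t; rewrite noise_comb1 mul1r.
have XW : indep P (e k) W.
  rewrite eE; apply: noise_comb_indep; rewrite -setI_eq0; apply/eqP/setP => l.
  by rewrite !inE; case: eqP => //= ->; rewrite ltnn.
have K12 : [disjoint K1 & (k |: K2)]%B.
  rewrite -setI_eq0; apply/eqP/setP => l; rewrite !inE.
  by case: (eqVneq l k) => [->|_] /=; rewrite ?ltnn//; case: ltngtP.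
have gX : generated_by e (k |: K2)%SET (e k).
  by apply: generated_by_member; rewrite !inE eqxx.
have gW : generated_by e (k |: K2)%SET W.
  (* A zero coefficient at [k] presents [W] over the same group of noise terms as [e k]. *)
  have -> : W = fun t => \sum_(l in (k |: K2)%SET) (if l == k then 0 else A j l / a) * e l t.
    apply/funext => t; rewrite /W /noise_comb big_setU1/=; last by rewrite inE ltnn.
    rewrite eqxx mul0r add0r; apply: eq_bigr => l; rewrite inE.
    by case: eqP => // ->; rewrite ltnn.
  exact: generated_by_lincomb.
have ZXW b (f : R * R -> R) : measurable_fun setT f ->
    indep P (noise_comb K1 b) (fun t => f (e k t, W t)).
  move=> mf; apply: (generated_by_indep (lingam_independent L) K12).
    exact: generated_by_lincomb.
  by apply: (measurableT_comp mf); apply/measurable_fun_pairP.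
pose v := \int[P]_t (e k t * e k t); pose w := \int[P]_t (W t * W t).
have v0 : 0 < v by exact: noise_var_gt0.
have [iX iXX X0] := cX; have [iW iWW W0] := cW.
have [iXW XW0] := indep_centeredM cX cW XW.
(* [j] lies in [K2] and A_jj = 1, so e_j enters [W] with coefficient 1 / a and contributes positive
   variance. *)
have w0 : 0 < w.
  pose W' := noise_comb (K2 :\ j)%SET (fun l => A j l / a).
  have WE t : W t = a^-1 * e j t + W' t.
    rewrite /W /noise_comb (big_setD1 j)/= ?inE//.
    by rewrite mixing_diag// div1r.
  have [iE iEE _] := lingam_centered_noise j.
  have cW' : centered P W' by exact: noise_comb_centered.
  have [iW' iWW' _] := cW'.
  have EW' : indep P (e j) W'.
    rewrite eE; apply: noise_comb_indep; rewrite -setI_eq0; apply/eqP/setP => l.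
    by rewrite !inE; case: eqP.
  have [iEW EW0] := indep_centeredM (lingam_centered_noise j) cW' EW'.
  have -> : w = a^-1 ^+ 2 * \int[P]_t (e j t * e j t) +
      (2 * a^-1) * \int[P]_t (e j t * W' t) + 1 * \int[P]_t (W' t * W' t).
    rewrite -(Rintegral_lin3 _ _ _ iEE iEW iWW').
    by apply: eq_Rintegral => t _ /=; rewrite WE; ring.
  rewrite EW0 mulr0 addr0 mul1r; apply: ltr_pwDl.
    by rewrite mulr_gt0 ?noise_var_gt0// exprn_even_gt0//= invr_eq0.
  by apply: Rintegral_ge0 => t _; exact: sqr_ge0.
(* The regression coefficient of x_k on x_j is a v / (a^2 (v + w)), which leaves (w e_k - v W) / (v
   + w) plus earlier noise; factoring out [b] normalizes the coefficient of [W] to -1. *)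
pose b := v / (v + w); pose c := w / v.
have vw0 : v + w != 0 by rewrite gt_eqF// addr_gt0.
have vn0 : v != 0 by rewrite gt_eqF.
have b0 : b != 0 by rewrite mulf_neq0// invr_eq0.
pose Z := noise_comb K1 (fun l => A k l / b).
have ZE t : Z t = noise_comb K1 (A k) t / b.
  rewrite /Z /noise_comb mulr_suml; apply: eq_bigr => l _; ring.
have [iZ iZZ Z0] : centered P Z by exact: noise_comb_centered.
have resE t : residual x j k t = b * (c * e k t - W t + Z t).
  have cov_kj : cov P (x k) (x j) = a * v.
    rewrite covE; [|exact: lingam_centered..].
    have [iZXW ZXW0] : integ (Z \* (fun t => e k t + W t)) /\
        \int[P]_t (Z t * (e k t + W t)) = 0.
      apply: indep_centeredM; [exact: noise_comb_centered|exact: centeredD|].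
      exact: (ZXW (fun l => A k l / b) (fun z => z.1 + z.2) (measurable_funD _ _)).
    transitivity (a * v + a * \int[P]_t (e k t * W t) +
        (a * b) * \int[P]_t (Z t * (e k t + W t))).
      rewrite /v -(Rintegral_lin3 _ _ _ iXX iXW iZXW).
      by apply: eq_Rintegral => s _ /=; rewrite xkE xjE ZE; field.
    by rewrite XW0 ZXW0 !mulr0 !addr0.
  have var_j : var P (x j) = a ^+ 2 * (v + w).
    rewrite varE; last exact: lingam_centered.
    transitivity (a ^+ 2 * v + (2 * a ^+ 2) * \int[P]_t (e k t * W t) + a ^+ 2 * w).
      rewrite /v /w -(Rintegral_lin3 _ _ _ iXX iXW iWW).
      by apply: eq_Rintegral => s _ /=; rewrite xjE; ring.
    by rewrite XW0 mulr0 addr0 mulrDr.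
  have -> : residual x j k t = x k t - cov P (x k) (x j) / var P (x j) * x j t.
    by [].
  rewrite cov_kj var_j xjE xkE ZE /c /b.
  by field; rewrite vn0 vw0 Ajk.
have := lingam_nongaussian L (i := k); apply.
apply: (gaussian_of_characteristic_function v0) => t t0.
have UV : indep P (fun t => e k t + W t) (fun t => c * e k t - W t + Z t).
  have -> : (fun t => e k t + W t) = (fun y => a^-1 * y) \o x j.
    by apply/funext => s /=; rewrite xjE; field.
  have -> : (fun t => c * e k t - W t + Z t) = (fun y => b^-1 * y) \o residual x j k.
    apply/funext => s; rewrite -[RHS]/(b^-1 * residual x j k s) resE.
    by field.
  by apply: indep_comp; [exact: measurable_funM|exact: measurable_funM|exact: xj_indep].
have c0 : 0 < c by rewrite divr_gt0.
have cE : c * v = w by rewrite /c divfK.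
exact: (two_variable_darmois_skitovich iX iXX X0 iW iWW W0 iZ iZZ Z0 XW
  (ZXW _) c0 cE UV t0).
Qed.

Lemma independent_of_residualsP j : independent_of_residuals x j <-> exogenous B j.
Proof.
split; first exact: independent_of_residuals_exogenous.
exact: exogenous_independent_of_residuals.
Qed.

End fixed_model.
End lingam_theory.

(** * The model that holds for the residuals *)

Section residual_model.
Context d (T : measurableType d) (R : realType) (P : probability T R).

Lemma mutually_independent_inj m n (f : 'I_m -> 'I_n)
    (e : 'I_n -> {RV P >-> R}) : injective f ->
  mutually_independent e -> mutually_independent (fun i => e (f i)).
Proof.
move=> f_inj e_indep J A mA.
pose C l := if [pick i | f i == l] is Some i then A i else setT.
have CE i : C (f i) = A i.
  rewrite /C; case: pickP => [i' /eqP /f_inj -> //|/(_ i)]; by rewrite eqxx.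
have mC l : measurable (C l) by rewrite /C; case: pickP.
have := e_indep (f @: J)%SET C mC.
rewrite big_imset/=; last by move=> i i' _ _; exact: f_inj.
under eq_bigr do rewrite CE.
move=> <-; congr (P _); apply/seteqP; split=> [t h l /= /imsetP[i iJ ->]|t h i /= iJ].
  by rewrite CE; exact: h.
by have := h (f i); rewrite /= CE; apply; exact: imset_f.
Qed.

(** The residuals are x_i - A_ij e_j. Column j of A satisfies A_ij = sum_l B_il A_lj for i != j, so
    the residuals obey the same equations as x outside row j; the residual of x_j itself is 0, which
    removes column j. *)
Lemma lingam_residual_vector n (x : 'I_n.+1 -> {RV P >-> R}) (B : 'M[R]_n.+1)
    (e : 'I_n.+1 -> {RV P >-> R}) j : lingam x B e -> exogenous B j ->
  lingam (residual_vector x j)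
    (\matrix_(a, b) B (lift j a) (lift j b)) (fun i => e (lift j i)).
Proof.
move=> L Bj; have acyclic := lingam_acyclic L.
split.
- move=> i t; pose A := mixing B.
  have resE a : residual x j a t = x a t - A a j * e j t.
    exact: exogenous_residual.
  have resj : residual x j j t = 0.
    by rewrite resE (exogenousE L)// mixing_diag// mul1r subrr.
  have AE a : a != j -> A a j = \sum_l B a l * A l j.
    by move=> aj; rewrite {1}/A mixingEl// !mxE (negbTE aj) add0r.
  rewrite /residual_vector resE (lingam_model L) AE; last by rewrite eq_sym neq_lift.
  transitivity (\sum_l B (lift j i) l * residual x j l t + e (lift j i) t).
    rewrite mulr_suml addrAC -sumrB; congr (_ + _); apply: eq_bigr => l _.
    by rewrite resE; ring.
  rewrite (bigD1_ord j)// resj mulr0 /= add0r; congr (_ + _).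
  by apply: eq_bigr => l _; rewrite mxE.
- have [k [k_inj Bk]] := acyclic_causal_rank acyclic.
  apply: (@causal_rank_acyclic _ _ _ (k \o lift j)); split.
    by apply: inj_comp => //; exact: lift_inj.
  by move=> a b ab; rewrite mxE; exact: Bk.
- by apply: mutually_independent_inj; [exact: lift_inj|exact: lingam_independent L].
- by move=> i; exact: (lingam_continuous L).
- by move=> i; exact: (lingam_nongaussian L).
- by move=> i; exact: (lingam_square_integrable L).
- by move=> i; exact: (lingam_mean0 L).
- by move=> i; exact: (lingam_var_neq0 L).
Qed.

End residual_model.

(** * Correctness of the ordering process *)

Section ordering.
Context d (T : measurableType d) (R : realType) (P : probability T R).
Variables (p : nat) (x : 'I_p -> {RV P >-> R}) (B : 'M[R]_p)
  (e : 'I_p -> {RV P >-> R}).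
Hypothesis L : lingam x B e.

(** [index i s] is [size s] for an unplaced [i], so the last clause also says that no unplaced
    variable influences a placed one. *)
Lemma ordering_state_invariant n (y : 'I_n -> {RV P >-> R}) sub s :
  ordering_state x y sub s ->
  [/\ lingam y (\matrix_(a, b) B (sub a) (sub b)) (fun i => e (sub i)),
      injective sub, uniq s,
      forall i, (i \in s) = ~~ [exists a, sub a == i]
    & forall i j, (index j s < index i s)%N -> B j i = 0].
Proof.
elim=> {n y sub s} [|n y sub s j _ [Ly sub_inj us sE Bs] yj].
  split=> //.
  - have -> : \matrix_(a, b) B (id a) (id b) = B by apply/matrixP => a b; rewrite mxE.
    exact: L.
  - by move=> i; apply/esym/negbTE; rewrite negbK; apply/existsP; exists i.
have Bj := proj1 (independent_of_residualsP Ly j) yj.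
split.
- have := lingam_residual_vector Ly Bj.
  have -> : \matrix_(a, b) (\matrix_(a', b') B (sub a') (sub b')) (lift j a) (lift j b) =
      \matrix_(a, b) B ((sub \o lift j) a) ((sub \o lift j) b).
    by apply/matrixP => a b; rewrite !mxE.
  exact.
- by apply: inj_comp => //; exact: lift_inj.
- rewrite rcons_uniq us andbT sE negbK; apply/existsP; exists j; exact: eqxx.
- move=> i; rewrite mem_rcons inE sE.
  have [->|ij] /= := eqVneq i (sub j).
    apply/esym/existsP => -[a /eqP /sub_inj /eqP]; by rewrite eq_sym (negbTE (neq_lift _ _)).
  congr (~~ _); apply/existsP/existsP => -[a /eqP ai].
    have ja : j != a by apply: contra ij => /eqP ->; rewrite ai.
    by have [b ab _] := unlift_some ja; exists b; rewrite /= -ab ai.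
  by exists (lift j a); rewrite -ai.
- move=> i l; rewrite -!cats1 !index_cat.
  have sj : sub j \notin s.
    by rewrite sE negbK; apply/existsP; exists j.
  case: (boolP (l \in s)) => ls; case: (boolP (i \in s)) => is_.
  + exact: Bs.
  + move=> _; apply: Bs; rewrite [X in (_ < X)%N]memNindex//.
    by rewrite index_mem.
  + move=> h; have := leq_trans h (ltnW _ : (index i s <= size s)%N).
    by rewrite index_mem is_ => /(_ isT); rewrite ltnNge leq_addr.
  (* Both are outside [s], so the strict inequality forces [l = sub j] with [i] still unplaced: this
     is the exogeneity of [j] in the current model. *)
  + rewrite ltn_add2l /=; case: eqP => [<-|_]; last by case: eqP.
    case: eqP => // /eqP ij _.
    have /existsP[a /eqP ai] : [exists a, sub a == i] by rewrite -[X in is_true X]negbK -sE.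
    have aj : a != j by apply: contra ij => /eqP <-; rewrite ai.
    by have := Bj a aj; rewrite mxE ai.
Qed.

Lemma ordering_state_progress n (y : 'I_n.+1 -> {RV P >-> R}) sub s :
  ordering_state x y sub s -> exists j, independent_of_residuals y j.
Proof.
move=> /ordering_state_invariant[Ly _ _ _ _].
have [j Bj] := exists_exogenous (lingam_acyclic Ly) ord0.
by exists j; exact/(independent_of_residualsP Ly).
Qed.

Lemma ordering_state_terminates n (y : 'I_n -> {RV P >-> R}) sub s :
  ordering_state x y sub s ->
  exists (y0 : 'I_0 -> {RV P >-> R}) (sub0 : 'I_0 -> 'I_p) (s0 : seq 'I_p),
    ordering_state x y0 sub0 s0.
Proof.
elim: n y sub s => [y sub s st|n IH y sub s st]; first by exists y, sub, s.
have [j yj] := ordering_state_progress st.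
exact: IH (OrderingStep st yj).
Qed.

Lemma ordering_state_causal_order (y : 'I_0 -> {RV P >-> R}) sub s :
  ordering_state x y sub s ->
  perm_eq s (enum 'I_p) /\ causal_order x B e (fun i => index i s).
Proof.
move=> /ordering_state_invariant[_ _ us sE Bs].
have ins i : i \in s by rewrite sE; apply/existsP => -[[]].
have idx_inj : injective (fun i => index i s).
  by move=> i j; exact: index_inj.
split; first by apply: uniq_perm => //; [exact: enum_uniq|move=> i; rewrite ins mem_enum].
split=> //.
(* The invariant compares distinct positions only; the diagonal entries vanish by acyclicity. *)
have [k kB] := acyclic_causal_rank (lingam_acyclic L).
move=> i t; rewrite (lingam_model L); congr (_ + _).
rewrite [RHS]big_mkcond /=; apply: eq_bigr => j _; case: ifP => // /negbT.
rewrite -leqNgt leq_eqVlt => /orP[/eqP /idx_inj ->|/Bs ->]; last by rewrite mul0r.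
by rewrite kB.2 ?mul0r.
Qed.

End ordering.

Theorem mainTheorem1 (d : measure_display) (T : measurableType d)
    (R : realType) (P : probability T R) (p : nat)
    (x : 'I_p -> {RV P >-> R}) (B : 'M[R]_p) (e : 'I_p -> {RV P >-> R})
    (x_lingam : lingam x B e) (x_faithful : correlation_faithful x B e) :
  (* at every stage: a LiNGAM model holds for the current input, the criterion
     finds exactly its exogenous variables, and the process can go on *)
  (forall (n : nat) (y : 'I_n -> {RV P >-> R}) (sub : 'I_n -> 'I_p)
      (s : seq 'I_p), ordering_state x y sub s ->
    (exists (B' : 'M[R]_n) (e' : 'I_n -> {RV P >-> R}), lingam y B' e') /\
    (forall (B' : 'M[R]_n) (e' : 'I_n -> {RV P >-> R}), lingam y B' e' ->
      forall j : 'I_n, independent_of_residuals y j <-> exogenous B' j) /\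
    ((0 < n)%N -> exists j : 'I_n, independent_of_residuals y j)) /\
  (* the process can be run until no variable is left *)
  (exists (y : 'I_0 -> {RV P >-> R}) (sub : 'I_0 -> 'I_p) (s : seq 'I_p),
    ordering_state x y sub s) /\
  (* and then it has produced a causal order *)
  (forall (y : 'I_0 -> {RV P >-> R}) (sub : 'I_0 -> 'I_p) (s : seq 'I_p),
    ordering_state x y sub s ->
    perm_eq s (enum 'I_p) /\ causal_order x B e (fun i => index i s)).
Proof.
split; last split.
- move=> n y sub s st; split; last split.
  + by have [Ly _ _ _ _] := ordering_state_invariant x_lingam st; do 2 eexists; exact: Ly.
  + by move=> B' e' Ly j; exact: independent_of_residualsP Ly j.
  + case: n y sub st => // n y sub st _.
    exact: ordering_state_progress x_lingam _ _ _ _ st.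
- exact: ordering_state_terminates x_lingam _ _ _ _ (OrderingStart x).
- exact: ordering_state_causal_order.
Qed.
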